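(* Let $n$ balls in the Euclidean space $\mathbb{R}^3$ be given (by their centers and radii), with $k$ different types of radii (i.e., $k$ distinct radius values), such that the ball centers are contained on $r$ parallel planes. Then a maximum clique in the corresponding ball graph can be computed in $O(n^{2rk}(f(n)+n^2r))$ time, where $f(n)$ is the time to compute a maximum matching in an $n$-vertex bipartite graph.
   Context: The ball graph corresponding to a set of balls in $\mathbb{R}^3$ has one vertex per ball, and two vertices are adjacent if and only if the corresponding balls intersect (i.e., the distance between their centers is at most the sum of their radii). A maximum clique is a maximum-cardinality subset of pairwise adjacent vertices. The geometric representation (the balls themselves) is given as input. *)

(* Defs.v *)
From HB Require Import structures.
From mathcomp Require Import all_boot all_order all_algebra.
From mathcomp Require Import reals.

Set Implicit Arguments.
Unset Strict Implicit.
Unset Printing Implicit Defensive.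

Import Order.TTheory GRing.Theory Num.Theory.

Local Open Scope nat_scope.

(** * Graphs *)

Definition is_clique (T : finType) (e : rel T) (S : {set T}) : Prop :=
  {in S &, forall x y, x != y -> e x y}.

Definition is_maximum_clique (T : finType) (e : rel T) (S : {set T}) : Prop :=
  is_clique e S /\ forall S' : {set T}, is_clique e S' -> #|S'| <= #|S|.

Definition is_bipartite (T : finType) (e : rel T) : Prop :=
  symmetric e /\
  exists A : {set T}, forall x y, e x y -> (x \in A) != (y \in A).

Definition edges (T : finType) (e : rel T) : {set {set T}} :=
  [set [set p.1; p.2] | p : T * T & e p.1 p.2].

Definition is_matching (T : finType) (e : rel T) (M : {set {set T}}) : Prop :=
  M \subset edges e /\ trivIset M.

Definition is_maximum_matching (T : finType) (e : rel T) (M : {set {set T}})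
    : Prop :=
  is_matching e M /\
  forall M' : {set {set T}}, is_matching e M' -> #|M'| <= #|M|.

(** * Balls in Euclidean space *)

Section Balls.
Variable R : realType.
Local Open Scope ring_scope.

Definition edist (p q : 'rV[R]_3) : R :=
  Num.sqrt (\sum_(l < 3) (p ord0 l - q ord0 l) ^+ 2).

Definition ball_graph n (center : 'I_n -> 'rV[R]_3) (radius : 'I_n -> R)
    : rel 'I_n :=
  fun i j => (i != j) && (edist (center i) (center j) <= radius i + radius j).

Definition num_radii n (radius : 'I_n -> R) : nat :=
  size (undup [seq radius i | i <- enum 'I_n]).

(* The r planes are {p | <u, p> = c j}, j < r, with common normal vector u. *)
Definition on_parallel_planes n (center : 'I_n -> 'rV[R]_3) (r : nat) : Prop :=
  exists (u : 'rV[R]_3) (c : 'I_r -> R),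
    [/\ u != 0, injective c &
        forall i, exists j, \sum_(l < 3) u ord0 l * center i ord0 l = c j].

End Balls.

(** * The real RAM

  A program works on finitely many infinite arrays of natural numbers and
  finitely many infinite arrays of real numbers, indexed by natural numbers
  (array a at index 0 serves as a scalar variable).  Array names are constants
  of the program text; indices may be computed.  The naturals only have
  addition and truncated subtraction, so that long integers cannot be abused
  as in unit-cost machines with multiplication and division on integers; the
  reals have exact field operations and comparisons, but there is no rounding
  and no way to use a real as an index.  Every constant, memory access,
  operation and test costs one time unit.  Division by 0 yields 0. *)

Inductive iexp : Type :=
| IConst of nat
| IGet of nat & iexp
| IAdd of iexp & iexp
| ISub of iexp & iexp.

Inductive rexp : Type :=
| RConst of nat
| RGet of nat & iexp
| RAdd of rexp & rexp
| RSub of rexp & rexp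
| RMul of rexp & rexp
| RDiv of rexp & rexp.

Inductive bexp : Type :=
| BLeI of iexp & iexp
| BLeR of rexp & rexp
| BNot of bexp
| BAnd of bexp & bexp.

Inductive com : Type :=
| Skip
| SetI of nat & iexp & iexp   (* SetI a i e : a[i] := e *)
| SetR of nat & iexp & rexp
| Seq of com & com
| Ite of bexp & com & com
| While of bexp & com.

Fixpoint icost (e : iexp) : nat :=
  match e with
  | IConst _ => 1
  | IGet _ i => (icost i).+1
  | IAdd e1 e2 | ISub e1 e2 => (icost e1 + icost e2).+1
  end.

Fixpoint rcost (e : rexp) : nat :=
  match e with
  | RConst _ => 1
  | RGet _ i => (icost i).+1
  | RAdd e1 e2 | RSub e1 e2 | RMul e1 e2 | RDiv e1 e2 =>
      (rcost e1 + rcost e2).+1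
  end.

Fixpoint bcost (b : bexp) : nat :=
  match b with
  | BLeI e1 e2 => (icost e1 + icost e2).+1
  | BLeR e1 e2 => (rcost e1 + rcost e2).+1
  | BNot b1 => (bcost b1).+1
  | BAnd b1 b2 => (bcost b1 + bcost b2).+1
  end.

Section Semantics.
Variable R : realType.

(* ints s a i (resp. reals s a i) is the content of a[i]. *)
Record state : Type := State {
  ints : nat -> nat -> nat;
  reals : nat -> nat -> R
}.

Definition update (T : Type) (m : nat -> nat -> T) (a i : nat) (v : T)
    : nat -> nat -> T :=
  fun a' i' => if (a' == a) && (i' == i) then v else m a' i'.

Fixpoint ieval (s : state) (e : iexp) : nat :=
  match e with
  | IConst m => m
  | IGet a i => ints s a (ieval s i)
  | IAdd e1 e2 => ieval s e1 + ieval s e2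
  | ISub e1 e2 => ieval s e1 - ieval s e2
  end.

Fixpoint reval (s : state) (e : rexp) : R :=
  match e with
  | RConst m => (m%:R)%R
  | RGet a i => reals s a (ieval s i)
  | RAdd e1 e2 => (reval s e1 + reval s e2)%R
  | RSub e1 e2 => (reval s e1 - reval s e2)%R
  | RMul e1 e2 => (reval s e1 * reval s e2)%R
  | RDiv e1 e2 => (reval s e1 / reval s e2)%R
  end.

Fixpoint beval (s : state) (b : bexp) : bool :=
  match b with
  | BLeI e1 e2 => ieval s e1 <= ieval s e2
  | BLeR e1 e2 => (reval s e1 <= reval s e2)%R
  | BNot b1 => ~~ beval s b1
  | BAnd b1 b2 => beval s b1 && beval s b2
  end.

(* exec c s t s' : started in s, the program c halts in s' after t time
   units. *)
Inductive exec : com -> state -> nat -> state -> Prop :=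
| ExecSkip s : exec Skip s 1 s
| ExecSetI s a i e :
    exec (SetI a i e) s (icost i + icost e).+1
      (State (update (ints s) a (ieval s i) (ieval s e)) (reals s))
| ExecSetR s a i e :
    exec (SetR a i e) s (icost i + rcost e).+1
      (State (ints s) (update (reals s) a (ieval s i) (reval s e)))
| ExecSeq s s1 s2 t1 t2 c1 c2 :
    exec c1 s t1 s1 -> exec c2 s1 t2 s2 -> exec (Seq c1 c2) s (t1 + t2) s2
| ExecIte s s1 t b c1 c2 :
    exec (if beval s b then c1 else c2) s t s1 ->
    exec (Ite b c1 c2) s (bcost b + t) s1
| ExecWhileFalse s b c :
    beval s b = false -> exec (While b c) s (bcost b) s
| ExecWhileTrue s s1 s2 t1 t2 b c :
    beval s b = true -> exec c s t1 s1 -> exec (While b c) s1 t2 s2 ->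
    exec (While b c) s (bcost b + t1 + t2) s2.

Definition halts_within (c : com) (s : state) (T : nat) (Q : state -> Prop)
    : Prop :=
  exists (t : nat) (s' : state), [/\ exec c s t s', t <= T & Q s'].

Lemma exec_det c s t s' t2 s2 :
  exec c s t s' -> exec c s t2 s2 -> t2 = t /\ s2 = s'.
Proof.
move=> H; elim: H t2 s2 => {c s t s'}.
- by move=> s t2 s2 H; inversion H.
- by move=> s a i e t2 s2 H; inversion H.
- by move=> s a i e t2 s2 H; inversion H.
- move=> s s1 s2 t1 t2 c1 c2 _ IH1 _ IH2 t3 s3 H.
  inversion H as [| | | ? u1 ? v1 v2 ? ? E1 E2 | | |]; subst.
  have [? ?] := IH1 _ _ E1; subst.
  by have [? ?] := IH2 _ _ E2; subst.
- move=> s s1 t b c1 c2 _ IH t2 s2 H.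
  inversion H as [| | | | ? ? v ? ? ? E | |]; subst.
  by have [? ?] := IH _ _ E; subst.
- move=> s b c bF t2 s2 H.
  by inversion H as [| | | | | | ? ? ? ? ? ? ? bT]; subst => //; rewrite bF in bT.
- move=> s s1 s2 t1 t2 b c bT _ IH1 _ IH2 t3 s3 H.
  inversion H as [| | | | | ? ? ? bF | ? u1 ? v1 v2 ? ? ? E1 E2]; subst.
    by rewrite bT in bF.
  have [? ?] := IH1 _ _ E1; subst.
  by have [? ?] := IH2 _ _ E2; subst.
Qed.

(** * Encoding of inputs and outputs

  Nothing is assumed about the initial content of the cells that are not
  mentioned by the encoding of the input (memory is uninitialised). *)

Definition encodes_graph n (e : rel 'I_n) (s : state) : Prop :=
  ints s 0 0 = n /\ forall i j : 'I_n, ints s 1 (i * n + j) = e i j.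

(* Array 2 holds the partner of each vertex, shifted by one; the value is not
   in {1, .., n} for unmatched vertices. *)
Definition encodes_matching n (M : {set {set 'I_n}}) (s : state) : Prop :=
  forall i j : 'I_n, (ints s 2 i == j.+1) = ([set i; j] \in M).

Definition encodes_balls n (center : 'I_n -> 'rV[R]_3) (radius : 'I_n -> R)
    (s : state) : Prop :=
  [/\ ints s 0 0 = n,
      forall (i : 'I_n) (l : 'I_3), reals s l i = center i ord0 l &
      forall i : 'I_n, reals s 3 i = radius i].

Definition encodes_vertex_set n (S : {set 'I_n}) (s : state) : Prop :=
  forall i : 'I_n, (ints s 1 i != 0) = (i \in S).

(* c computes a maximum matching of every n-vertex bipartite graph in time at
   most f n.  The bipartition is not part of the input. *)
Definition computes_bipartite_matching (c : com) (f : nat -> nat) : Prop :=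
  forall (n : nat) (e : rel 'I_n) (s : state),
    is_bipartite e -> encodes_graph e s ->
    halts_within c s (f n) (fun s' =>
      exists M, is_maximum_matching e M /\ encodes_matching M s').

Definition computes_maximum_clique_of_balls (c : com) n
    (center : 'I_n -> 'rV[R]_3) (radius : 'I_n -> R) (T : nat) : Prop :=
  forall s : state, encodes_balls center radius s ->
    halts_within c s T (fun s' =>
      exists S, is_maximum_clique (ball_graph center radius) S /\
                encodes_vertex_set S s').

End Semantics.

(* Main.v *)
(**
  Fix a nonzero direction w parallel to all the planes, and call two balls
  equivalent when they lie in the same plane and have the same radius; there are
  m <= rk classes.  For a maximum clique, guess in each class the two members
  that are extreme in the direction orthogonal to w inside the plane.  Keep the
  balls that meet all the guessed balls and project along w into the segment of
  their own class, and split them into those above and those below that segment.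
  Two balls u, v on the same side intersect: if w.(u - v) >= 0 then v can be
  moved down to a point of the segment of its class without coming closer to u,
  and all points of that segment are close enough to u; otherwise exchange u and
  v.  So the kept balls induce a co-bipartite graph, whose maximum cliques have
  a size given by a maximum matching of the complement (Koenig).  All n^(2m)
  guesses are enumerated by an odometer; an absent class is guessed by a pair
  lying outside of it.  The clique itself is extracted from the best guess by
  deleting balls as long as the size does not drop.

  The planes are not part of the input.  A frame spanned by two differences of
  centers is enough: if some differences of coplanar centers are independent
  they span the planes, and otherwise any plane containing their common
  direction will do.  Three virtual points serve the degenerate cases.  The n^2
  differences from the first center suffice when r = 1; all n^4 frames are tried
  only when rk >= 2, where the budget allows it.
*)
Require Import Defs.
From mathcomp Require Import all_boot all_order all_algebra.
From mathcomp Require Import boolp reals.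
From mathcomp Require Import zify ring lra.

Set Implicit Arguments.
Unset Strict Implicit.
Unset Printing Implicit Defensive.

Import Order.TTheory GRing.Theory Num.Theory.

Local Open Scope nat_scope.

(** * Running times of structured programs *)

(** Syntactic test that [c] assigns to no cell of the integer array [a]. It is boolean so that, for
    concrete array names, frame conditions are settled by computation. *)
Fixpoint nowI (a : nat) (c : com) : bool :=
  match c with
  | Skip | SetR _ _ _ => true
  | SetI a' _ _ => a != a'
  | Seq c1 c2 | Ite _ c1 c2 => nowI a c1 && nowI a c2
  | While _ c1 => nowI a c1
  end.

Fixpoint nowR (a : nat) (c : com) : bool :=
  match c with
  | Skip | SetI _ _ _ => true
  | SetR a' _ _ => a != a'
  | Seq c1 c2 | Ite _ c1 c2 => nowR a c1 && nowR a c2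
  | While _ c1 => nowR a c1
  end.

Fixpoint loopfree (c : com) : bool :=
  match c with
  | Skip | SetI _ _ _ | SetR _ _ _ => true
  | Seq c1 c2 | Ite _ c1 c2 => loopfree c1 && loopfree c2
  | While _ _ => false
  end.

(** A bound on the running time of loop-free programs; the value at [While] is a dummy. *)
Fixpoint wcost (c : com) : nat :=
  match c with
  | Skip => 1
  | SetI _ i e => (icost i + icost e).+1
  | SetR _ i e => (icost i + rcost e).+1
  | Seq c1 c2 => wcost c1 + wcost c2
  | Ite b c1 c2 => bcost b + maxn (wcost c1) (wcost c2)
  | While _ _ => 0
  end.

Section Hoare.
Variable R : realType.
Implicit Types (s : state R) (c : com).

Definition frame c s s' : Prop :=
  (forall a, nowI a c -> ints s' a = ints s a) /\
  (forall a, nowR a c -> reals s' a = reals s a).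

Lemma frame_trans c s1 s2 s3 : frame c s1 s2 -> frame c s2 s3 -> frame c s1 s3.
Proof.
move=> [F1 G1] [F2 G2]; split=> a Ha; first by rewrite F2 // F1.
by rewrite G2 // G1.
Qed.

Lemma frame_sub c c' s s' : (forall a, nowI a c' -> nowI a c) ->
  (forall a, nowR a c' -> nowR a c) -> frame c s s' -> frame c' s s'.
Proof. by move=> HI HR [F G]; split=> a Ha; [apply/F/HI|apply/G/HR]. Qed.

Lemma update_neq T (m : nat -> nat -> T) a i v a' :
  a' != a -> update m a i v a' = m a'.
Proof. by rewrite /update => /negbTE ->. Qed.

Lemma exec_frame c s t s' : exec c s t s' -> frame c s s'.
Proof.
elim=> {c s t s'} //=.
- by move=> s a i e; split=> a' Ha //=; rewrite update_neq.
- by move=> s a i e; split=> a' Ha //=; rewrite update_neq.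
- move=> s s1 s2 t1 t2 c1 c2 _ H1 _ H2; apply: (@frame_trans _ _ s1).
    by apply: frame_sub H1 => a /= /andP[].
  by apply: frame_sub H2 => a /= /andP[].
- by move=> s s1 t b c1 c2 _; apply: frame_sub => a /= /andP[]; case: beval.
- by move=> s s1 s2 t1 t2 b c _ _ H1 _; apply: frame_trans.
Qed.

Lemma hw_weak c s T T' (Q Q' : state R -> Prop) :
  halts_within c s T Q -> T <= T' -> (forall s', frame c s s' -> Q s' -> Q' s') ->
  halts_within c s T' Q'.
Proof.
move=> [t [s' [E tT Qs]]] TT H; exists t, s'; split=> //.
  exact: leq_trans tT TT.
by apply: H => //; apply: exec_frame E.
Qed.

(** The postcondition of [c1] is the remaining goal about [c2], so a program is verified from left
    to right, with the frame of each executed piece supplied for free. *)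
Lemma hw_seq c1 c2 s T1 T2 T (Q : state R -> Prop) :
  halts_within c1 s T1 (fun s1 => frame c1 s s1 -> halts_within c2 s1 T2 Q) ->
  T1 + T2 <= T -> halts_within (Seq c1 c2) s T Q.
Proof.
move=> [t [s' [E tT H]]] TT.
have [t2 [s2 [E2 tT2 Qs]]] := H (exec_frame E).
exists (t + t2), s2; split=> //; first exact: ExecSeq E E2.
by apply: leq_trans TT; apply: leq_add.
Qed.

Lemma hw_ite b c1 c2 s T T' (Q : state R -> Prop) :
  (beval s b -> halts_within c1 s T Q) ->
  (~~ beval s b -> halts_within c2 s T Q) ->
  bcost b + T <= T' -> halts_within (Ite b c1 c2) s T' Q.
Proof.
move=> H1 H2 TT.
have [t [s' [E tT Qs]]] : halts_within (if beval s b then c1 else c2) s T Q.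
  by case: (beval s b) H1 H2 => [H _|_ H]; apply: H.
exists (bcost b + t), s'; split=> //; first exact: ExecIte.
by apply: leq_trans TT; rewrite leq_add2l.
Qed.

(** Symbolic execution of loop-free programs, which turns their verification into simplification;
    the value at [While] is a dummy. *)
Fixpoint ev c s : state R :=
  match c with
  | Skip | While _ _ => s
  | SetI a i e => State (update (ints s) a (ieval s i) (ieval s e)) (reals s)
  | SetR a i e => State (ints s) (update (reals s) a (ieval s i) (reval s e))
  | Seq c1 c2 => ev c2 (ev c1 s)
  | Ite b c1 c2 => if beval s b then ev c1 s else ev c2 s
  end.

Lemma exec_ev c s : loopfree c -> exists2 t, t <= wcost c & exec c s t (ev c s).
Proof.
elim: c s => //=.
- by move=> s _; exists 1 => //; constructor.
- by move=> a i e s _; eexists; last constructor.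
- by move=> a i e s _; eexists; last constructor.
- move=> c1 IH1 c2 IH2 s /andP[L1 L2].
  have [t1 H1 E1] := IH1 s L1; have [t2 H2 E2] := IH2 (ev c1 s) L2.
  by exists (t1 + t2); [apply: leq_add|apply: ExecSeq E1 E2].
- move=> b c1 IH1 c2 IH2 s /andP[L1 L2].
  case Eb: (beval s b).
    have [t1 H1 E1] := IH1 s L1; exists (bcost b + t1).
      by rewrite leq_add2l leq_max H1.
    by apply: ExecIte; rewrite Eb.
  have [t1 H1 E1] := IH2 s L2; exists (bcost b + t1).
    by rewrite leq_add2l leq_max H1 orbT.
  by apply: ExecIte; rewrite Eb.
Qed.

Lemma hw_ev c s T (Q : state R -> Prop) :
  loopfree c -> wcost c <= T -> Q (ev c s) -> halts_within c s T Q.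
Proof.
move=> L CT H; have [t tT E] := exec_ev s L.
by exists t, (ev c s); split=> //; apply: leq_trans CT.
Qed.

Definition seti s a v : state R := State (update (ints s) a 0 v) (reals s).

Definition For (i : nat) (b : iexp) (body : com) : com :=
  Seq (SetI i (IConst 0) (IConst 0))
    (While (BNot (BLeI b (IGet i (IConst 0))))
      (Seq body (SetI i (IConst 0) (IAdd (IGet i (IConst 0)) (IConst 1))))).

(** [I k] speaks of the state whose counter already reads [k], hence the [seti] after the body. A
    round pays [icost b + 4] for the test, [T] for the body and 6 for the increment. *)
Lemma hw_for i b body (I : nat -> state R -> Prop) n T s0 T' (Q : state R -> Prop) :
  nowI i body ->
  (forall s, frame (For i b body) s0 s -> ieval s b = n) ->
  I 0 (seti s0 i 0) ->
  (forall k s, k < n -> frame (For i b body) s0 s -> ints s i 0 = k -> I k s ->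
     halts_within body s T (fun s' => frame body s s' -> ints s' i 0 = k ->
        I k.+1 (seti s' i k.+1))) ->
  (forall s, frame (For i b body) s0 s -> I n s -> Q s) ->
  n * (T + icost b + 10) + icost b + 7 <= T' ->
  halts_within (For i b body) s0 T' Q.
Proof.
move=> Hi Hb H0 Hstep HQ HT.
rewrite [X in halts_within X]/For; set w := While _ _.
(* Induction on the number [d] of remaining rounds; the counter stands at [n - d]. *)
suff main : forall d s, d <= n -> frame (For i b body) s0 s ->
    ints s i 0 = n - d -> I (n - d) s ->
    halts_within w s (d * (T + icost b + 10) + icost b + 4)
      (fun s' => frame (For i b body) s0 s' /\ I n s').
  apply: (@hw_seq _ _ _ 3 (n * (T + icost b + 10) + icost b + 4)); last by lia.
  apply: hw_ev => //= F.
  apply: (hw_weak (main n _ _ _ _ _)) => //=.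
  - split=> a Ha //=; rewrite update_neq //; by move: Ha => /= /and3P[].
  - by rewrite subnn /update !eqxx.
  - by rewrite subnn.
  - by move=> s' _ [F' I']; apply: HQ.
elim=> [|d IH] s dn F Ei HI.
  exists (icost b + 4), s; rewrite subn0 in Ei HI; split=> //.
  have -> : icost b + 4 = bcost (BNot (BLeI b (IGet i (IConst 0)))) by rewrite /=; lia.
  by apply: ExecWhileFalse; rewrite /= Hb // Ei leqnn.
have kn : n - d.+1 < n by lia.
have [t [s' [E tT H]]] := Hstep _ _ kn F Ei HI.
have F' := exec_frame E.
have Ei' : ints s' i 0 = n - d.+1 by rewrite F'.1.
have nd : (n - d.+1).+1 = n - d by lia.
have := H F' Ei'; rewrite nd => HI'.
have Fb : frame (For i b body) s0 s'.
  apply: frame_trans F _; apply: frame_sub F' => a /=.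
    by move=> /and3P[].
  by move=> /andP[].
have F'' : frame (For i b body) s0 (seti s' i (n - d)).
  apply: frame_trans Fb _; split=> a Ha //=; rewrite update_neq //; by move: Ha => /= /and3P[].
have Ei'' : ints (seti s' i (n - d)) i 0 = n - d by rewrite /= /update !eqxx.
have [t2 [s2 [E2 tT2 [F2 I2]]]] := IH _ (ltnW dn) F'' Ei'' HI'.
exists ((icost b + 4) + (t + 6) + t2), s2; split=> //; last by lia.
have -> : icost b + 4 = bcost (BNot (BLeI b (IGet i (IConst 0)))) by rewrite /=; lia.
apply: (@ExecWhileTrue _ _ (seti s' i (n - d))) => //.
  by rewrite /= Hb // Ei -ltnNge.
apply: ExecSeq E _.
have -> : seti s' i (n - d) = ev (SetI i (IConst 0) (IAdd (IGet i (IConst 0)) (IConst 1))) s'.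
  by rewrite /= Ei' addn1 nd.
exact: ExecSetI.
Qed.

(** * Odometers *)

Definition dig (b t j : nat) := (t %/ b ^ j) %% b.

(** Adds one to the number whose base-[bs] digits are in array [d], lowest digit first. The carry
    [cr] is still 1 at the end only on overflow, and this is how [Odo] knows that all digit
    sequences have been visited. *)
Definition OdoInc (d D bs cr oj : nat) : com :=
  Seq (SetI cr (IConst 0) (IConst 1))
  (For oj (IGet D (IConst 0))
    (Ite (BLeI (IConst 1) (IGet cr (IConst 0)))
      (Ite (BLeI (IAdd (IGet d (IGet oj (IConst 0))) (IConst 2)) (IGet bs (IConst 0)))
        (Seq (SetI d (IGet oj (IConst 0)) (IAdd (IGet d (IGet oj (IConst 0))) (IConst 1)))
          (SetI cr (IConst 0) (IConst 0)))
        (SetI d (IGet oj (IConst 0)) (IConst 0)))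
      Skip)).

Definition Odo (d D bs cr oj : nat) (body : com) : com :=
  Seq (For oj (IGet D (IConst 0)) (SetI d (IGet oj (IConst 0)) (IConst 0)))
  (Seq (SetI cr (IConst 0) (IConst 0))
  (While (BLeI (IGet cr (IConst 0)) (IConst 0)) (Seq body (OdoInc d D bs cr oj)))).

(** The quotient by [b ^ j] grows by one exactly when [b ^ j] divides [t.+1], that is, when a carry
    reaches position [j]. *)
Lemma digS b t j : 0 < b ->
  dig b t.+1 j = if b ^ j %| t.+1 then (if (dig b t j).+2 <= b then (dig b t j).+1 else 0)
                 else dig b t j.
Proof.
move=> b0; rewrite /dig divnS ?expn_gt0 ?b0 //.
case: ifP => _ //=; rewrite add1n.
have := ltn_mod (t %/ b ^ j) b; rewrite b0 => /idP H.
rewrite -addn1 -modnDml; case: ifP => H1.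
  by rewrite modn_small ?addn1.
have -> : (t %/ b ^ j) %% b + 1 = b by move/negbT: H1; rewrite -ltnNge; lia.
by rewrite modnn.
Qed.

(* The carry into position j+1 survives iff digit j was maximal. *)
Lemma carryS b t j : 0 < b ->
  (b ^ j.+1 %| t.+1) = (b ^ j %| t.+1) && ~~ ((dig b t j).+2 <= b).
Proof.
move=> b0; case D: (b ^ j %| t.+1); last first.
  apply/negbTE/negP => H; move/negP: D; apply.
  by apply: dvdn_trans H; rewrite expnS dvdn_mull.
have bj : 0 < b ^ j by rewrite expn_gt0 b0.
have E : (t %/ b ^ j).+1 = t.+1 %/ b ^ j by rewrite divnS // D.
rewrite expnS -{1}(divnK D) dvdn_pmul2r // -E /dig.
have Hm := ltn_pmod (t %/ b ^ j) b0.
rewrite {1}(divn_eq (t %/ b ^ j) b) -addnS dvdn_addr ?dvdn_mull //.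
rewrite -leqNgt; apply/idP/idP => H.
  by have := dvdn_leq (ltn0Sn _) H; lia.
by have -> : ((t %/ b ^ j) %% b).+1 = b by lia.
Qed.

Lemma dig_lt b t j : 0 < b -> dig b t j < b.
Proof. by move=> b0; rewrite ltn_mod. Qed.

Lemma hw_odoinc d D bs cr oj n b t s0 T' (Q : state R -> Prop) :
  uniq [:: d; D; bs; cr; oj] -> 0 < b ->
  ints s0 D 0 = n -> ints s0 bs 0 = b ->
  (forall j, j < n -> ints s0 d j = dig b t j) ->
  (forall s, frame (OdoInc d D bs cr oj) s0 s ->
     (forall j, j < n -> ints s d j = dig b t.+1 j) ->
     ints s cr 0 = (b ^ n %| t.+1) -> Q s) ->
  n * 40 + 20 <= T' ->
  halts_within (OdoInc d D bs cr oj) s0 T' Q.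
Proof.
rewrite /= !inE !negb_or => /and5P[/and4P[dD db dc dj] /and3P[Db Dc Dj] /andP[bc bj] cj _].
move=> b0 ED Eb Ed HQ HT.
apply: (@hw_seq _ _ _ 3 (n * 40 + 10)); last by lia.
apply: hw_ev => //= F.
apply: (@hw_for _ _ _ (fun k s => (forall j, j < n -> ints s d j = if j < k then dig b t.+1 j else dig b t j)
  /\ ints s cr 0 = (b ^ k %| t.+1)) n 27).
- by rewrite /= ![oj == _]eq_sym dj cj.
- move=> s [FI _]; rewrite /= FI /=.
    by rewrite update_neq // ED.
  by rewrite ![D == _]eq_sym !(eq_sym _ D) Dj Dc (eq_sym D) dD.
- split=> /=; first by move=> j jn; rewrite !update_neq // Ed.
  by rewrite update_neq // /update !eqxx expn0 dvd1n.
- move=> k s kn [FI _] Eoj [Hd Hc].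
  have Ebs : ints s bs 0 = b.
    rewrite FI /= ?update_neq //.
    by rewrite bj bc (eq_sym bs) db.
  apply: hw_ev => //.
  rewrite /= Ebs Hc Eoj (Hd _ kn) ltnn !addn1 addn2.
  case C: (b ^ k %| t.+1) => /=; first case: ifP => /= H.
  + move=> _ _; split=> [j jn|]; rewrite /= /update /= !eqxx ?(eq_sym cr d) ?(negbTE dc)
      ?(eq_sym oj) ?(negbTE dj) ?(negbTE cj) /=; last by rewrite carryS // C H.
    case: eqP => [->|/eqP jk]; first by rewrite ltnSn digS // C H.
    by rewrite Hd // ltnS [in RHS]leq_eqVlt (negbTE jk).
  + move=> _ _; split=> [j jn|]; rewrite /= /update /= ?eqxx ?(eq_sym cr d) ?(negbTE dc)
      ?(eq_sym oj) ?(negbTE dj) ?(negbTE cj) /=; last by rewrite Hc C carryS // C H.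
    case: eqP => [->|/eqP jk]; first by rewrite ltnSn digS // C H.
    by rewrite Hd // ltnS [in RHS]leq_eqVlt (negbTE jk).
  + move=> _ _; split=> [j jn|]; rewrite /= /update /=
      ?(negbTE dj) ?(negbTE cj) /=; last by rewrite Hc C carryS // C.
    rewrite Hd // ltnS [in RHS]leq_eqVlt.
    by case: eqP => [->|//]; rewrite ltnn digS // C.
- move=> s Fs [Hd Hc]; apply: HQ => //.
    apply: (@frame_trans _ _ _ _ _ (frame_sub _ _ Fs)).
    + split=> a //= /andP[ac _]; by rewrite update_neq.
    + by move=> a /= /andP[].
    + by [].
  by move=> j jn; rewrite Hd // jn.
by rewrite /=; lia.
Qed.

(** The premise on states that agree outside [d], [cr] and [oj] says that [I] ignores the private
    arrays of the odometer, so that incrementing it cannot destroy the invariant. *)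
Lemma hw_odo d D bs cr oj n b body (I : nat -> state R -> Prop) T s0 T' (Q : state R -> Prop) :
  uniq [:: d; D; bs; cr; oj] -> 0 < b -> 0 < n ->
  [&& nowI d body, nowI D body & nowI bs body] ->
  ints s0 D 0 = n -> ints s0 bs 0 = b ->
  (forall t s s', I t s -> (forall a, a \notin [:: d; cr; oj] -> ints s' a = ints s a) ->
     reals s' = reals s -> I t s') ->
  I 0 s0 ->
  (forall t s, t < b ^ n -> frame (Odo d D bs cr oj body) s0 s ->
     (forall j, j < n -> ints s d j = dig b t j) -> I t s ->
     halts_within body s T (fun s' => frame body s s' -> I t.+1 s')) ->
  (forall s, frame (Odo d D bs cr oj body) s0 s -> I (b ^ n) s -> Q s) ->
  b ^ n * (T + n * 40 + 30) + n * 20 + 20 <= T' ->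
  halts_within (Odo d D bs cr oj body) s0 T' Q.
Proof.
move=> U b0 n0 /and3P[Nd ND Nb] ED Eb stab I0 Hstep HQ HT.
move: (U); rewrite /= !inE !negb_or => /and5P[/and4P[dD db dc dj] /and3P[Db Dc Dj] /andP[bc bj] cj _].
have FD s : frame (Odo d D bs cr oj body) s0 s -> ints s D 0 = n.
  by move=> [FI _]; rewrite FI ?ED //= ND (eq_sym D d) dD Dc Dj.
have Fb s : frame (Odo d D bs cr oj body) s0 s -> ints s bs 0 = b.
  by move=> [FI _]; rewrite FI ?Eb //= Nb (eq_sym bs d) db bc bj.
have nowsub a : a \notin [:: d; cr; oj] -> nowI a (OdoInc d D bs cr oj).
  by rewrite /= !inE !negb_or => /and3P[-> -> ->].
apply: (@hw_seq _ _ _ (n * 16 + 9) (b ^ n * (T + n * 40 + 30) + 10)); last by lia.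
apply: (@hw_for _ _ _ (fun k s => (forall j, j < k -> ints s d j = 0) /\ I 0 s) n 4).
- by rewrite /= (eq_sym oj).
- move=> s [FI _]; rewrite /= FI ?ED //= (eq_sym D d) dD Dj //.
- split=> //; apply: stab I0 _ _ => //= a; rewrite !inE !negb_or => /and3P[_ _ aj].
  by rewrite update_neq.
- move=> k s kn _ Ej [Hd HI]; apply: hw_ev => // _ _; split=> [j|].
    rewrite ltnS leq_eqVlt /= update_neq // /update eqxx /= Ej.
    by case: eqP => //= _ /Hd.
  apply: stab HI _ _ => //= a; rewrite !inE !negb_or => /and3P[ad _ aj].
  by rewrite !update_neq.
- move=> s1 F1 [Hd HI] _.
  apply: (@hw_seq _ _ _ 3 (b ^ n * (T + n * 40 + 30) + 7)); last by lia.
  apply: hw_ev => // _.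
  set s2 := ev _ s1.
  have F2 : frame (Odo d D bs cr oj body) s0 s2.
    split=> a /=; last by move=> Ha; apply: F1.2 => /=.
    move=> /and3P[/andP[aj /andP[ad _]] ac _]; rewrite update_neq // F1.1 //=.
    by rewrite ad aj.
  have I2 : I 0 s2.
    apply: stab HI _ _ => //= a; rewrite !inE !negb_or => /and3P[ad ac aj].
    by rewrite !update_neq.
  have Hd2 j : j < n -> ints s2 d j = dig b 0 j.
    by move=> jn; rewrite /s2 /= update_neq // Hd // /dig div0n mod0n.
  have C2 : ints s2 cr 0 = 0 by rewrite /s2 /= /update !eqxx.
  clearbody s2; clear s1 F1 Hd HI.
  set w := While _ _.
  (* [e.+1] rounds remain. In the round with [e = 0] the increment overflows and sets the carry,
     which ends the loop; in the others [t.+1 < b ^ n] leaves the carry at 0. *)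
  suff main : forall e t s, t + e.+1 = b ^ n -> frame (Odo d D bs cr oj body) s0 s ->
     (forall j, j < n -> ints s d j = dig b t j) -> I t s -> ints s cr 0 = 0 ->
    halts_within w s (e.+1 * (T + n * 40 + 30) + 4) Q.
    have bn : 0 < b ^ n by rewrite expn_gt0 b0.
    apply: (hw_weak (main (b ^ n).-1 0 s2 _ F2 Hd2 I2 C2)) => //.
      by rewrite add0n prednK.
    by rewrite prednK //; lia.
  elim=> [|e IH] t s te F Hds HI C.
  + have tn : t < b ^ n by lia.
    have [t1 [s1 [E1 tT1 H1]]] := Hstep t s tn F Hds HI.
    have I1 := H1 (exec_frame E1); have F1 := exec_frame E1.
    have F1' : frame (Odo d D bs cr oj body) s0 s1.
      apply: frame_trans F _; apply: frame_sub F1 => a /=.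
        by move=> /and3P[_ _ /andP[]].
      by move=> /andP[].
    have Hds1 j : j < n -> ints s1 d j = dig b t j by move=> jn; rewrite F1.1 // Hds.
    have [t3 [s3 [E3 tT3 [F3 I3 C3]]]] :
      halts_within (OdoInc d D bs cr oj) s1 (n * 40 + 20)
       (fun s => [/\ frame (Odo d D bs cr oj body) s0 s, I t.+1 s & ints s cr 0 = (b ^ n %| t.+1)]).
      apply: (@hw_odoinc _ _ _ _ _ n b t) => //; rewrite ?FD ?Fb //.
      move=> s' F' _ HC; split=> //.
        apply: frame_trans F1' _; apply: frame_sub F' => a /=.
          by move=> /and3P[_ _ /andP[]].
        by [].
      apply: stab I1 _ _ => [a /nowsub Ha|]; first exact: F'.1.
      by apply: funext => a; apply: F'.2.
    exists (4 + (t1 + t3) + 4), s3; split; [|lia|].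
      apply: ExecWhileTrue; rewrite /= ?C //.
        exact: ExecSeq E1 E3.
      by apply: ExecWhileFalse; rewrite /= C3; have -> : t.+1 = b ^ n by [lia]; rewrite dvdnn.
    by apply: HQ => //; have <- : t.+1 = b ^ n by lia.
  + have tn : t < b ^ n by lia.
    have [t1 [s1 [E1 tT1 H1]]] := Hstep t s tn F Hds HI.
    have I1 := H1 (exec_frame E1); have F1 := exec_frame E1.
    have F1' : frame (Odo d D bs cr oj body) s0 s1.
      apply: frame_trans F _; apply: frame_sub F1 => a /=.
        by move=> /and3P[_ _ /andP[]].
      by move=> /andP[].
    have Hds1 j : j < n -> ints s1 d j = dig b t j by move=> jn; rewrite F1.1 // Hds.
    have [t3 [s3 [E3 tT3 [F3 I3 C3 Hd3]]]] :
      halts_within (OdoInc d D bs cr oj) s1 (n * 40 + 20)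
       (fun s => [/\ frame (Odo d D bs cr oj body) s0 s, I t.+1 s, ints s cr 0 = (b ^ n %| t.+1)
         & forall j, j < n -> ints s d j = dig b t.+1 j]).
      apply: (@hw_odoinc _ _ _ _ _ n b t) => //; rewrite ?FD ?Fb //.
      move=> s' F' Hd' HC; split=> //.
        apply: frame_trans F1' _; apply: frame_sub F' => a /=.
          by move=> /and3P[_ _ /andP[]].
        by [].
      apply: stab I1 _ _ => [a /nowsub Ha|]; first exact: F'.1.
      by apply: funext => a; apply: F'.2.
    have C4 : ints s3 cr 0 = 0.
      by rewrite C3; case: (boolP (_ %| _)) => // /(dvdn_leq (ltn0Sn _)); lia.
    have te' : t.+1 + e.+1 = b ^ n by lia.
    have [t4 [s4 [E4 tT4 Q4]]] := IH _ _ te' F3 Hd3 I3 C4.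
    exists (4 + (t1 + t3) + t4), s4; split=> //; last by move: tT4; rewrite [e.+2 * _]mulSn; move: (e.+1 * _) => z; lia.
    apply: ExecWhileTrue E4; rewrite /= ?C //.
    exact: ExecSeq E1 E3.
by rewrite /=; lia.
Qed.

(** * Renaming arrays *)

(* The matching program is moved to the arrays from 32 on, which leaves 0 to 31
   to the clique program; its input is then in 32 and 33, its output in 34. *)
Fixpoint shI (e : iexp) : iexp :=
  match e with
  | IConst m => IConst m
  | IGet a i => IGet (a + 32) (shI i)
  | IAdd e1 e2 => IAdd (shI e1) (shI e2)
  | ISub e1 e2 => ISub (shI e1) (shI e2)
  end.

Fixpoint shR (e : rexp) : rexp :=
  match e with
  | RConst m => RConst m
  | RGet a i => RGet (a + 32) (shI i)
  | RAdd e1 e2 => RAdd (shR e1) (shR e2)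
  | RSub e1 e2 => RSub (shR e1) (shR e2)
  | RMul e1 e2 => RMul (shR e1) (shR e2)
  | RDiv e1 e2 => RDiv (shR e1) (shR e2)
  end.

Fixpoint shB (b : bexp) : bexp :=
  match b with
  | BLeI e1 e2 => BLeI (shI e1) (shI e2)
  | BLeR e1 e2 => BLeR (shR e1) (shR e2)
  | BNot b1 => BNot (shB b1)
  | BAnd b1 b2 => BAnd (shB b1) (shB b2)
  end.

Fixpoint shift (c : com) : com :=
  match c with
  | Skip => Skip
  | SetI a i e => SetI (a + 32) (shI i) (shI e)
  | SetR a i e => SetR (a + 32) (shI i) (shR e)
  | Seq c1 c2 => Seq (shift c1) (shift c2)
  | Ite b c1 c2 => Ite (shB b) (shift c1) (shift c2)
  | While b c1 => While (shB b) (shift c1)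
  end.

Definition view s : state R :=
  State (fun a => ints s (a + 32)) (fun a => reals s (a + 32)).

Lemma ieval_sh s e : ieval s (shI e) = ieval (view s) e.
Proof. by elim: e => //= [a i ->|e1 -> e2 ->|e1 -> e2 ->]. Qed.

Lemma reval_sh s e : reval s (shR e) = reval (view s) e.
Proof. by elim: e => //= [a i|e1 -> e2 ->|e1 -> e2 ->|e1 -> e2 ->|e1 -> e2 ->] //; rewrite ieval_sh. Qed.

Lemma beval_sh s b : beval s (shB b) = beval (view s) b.
Proof. by elim: b => //= [e1 e2|e1 e2|b ->|b1 -> b2 ->] //; rewrite ?ieval_sh ?reval_sh. Qed.

Lemma icost_sh e : icost (shI e) = icost e.
Proof. by elim: e => //= [a i ->|e1 -> e2 ->|e1 -> e2 ->]. Qed.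

Lemma rcost_sh e : rcost (shR e) = rcost e.
Proof. by elim: e => //= [a i|e1 -> e2 ->|e1 -> e2 ->|e1 -> e2 ->|e1 -> e2 ->] //; rewrite icost_sh. Qed.

Lemma bcost_sh b : bcost (shB b) = bcost b.
Proof. by elim: b => //= [e1 e2|e1 e2|b ->|b1 -> b2 ->] //; rewrite ?icost_sh ?rcost_sh. Qed.

Lemma update_view T (m : nat -> nat -> T) a i v :
  (fun a' => update m (a + 32) i v (a' + 32)) = update (fun a' => m (a' + 32)) a i v.
Proof. by apply: funext => a'; apply: funext => i'; rewrite /update eqn_add2r. Qed.

(** A simulation with equal running time: renaming arrays changes no cost, and [view] reads the
    moved arrays under their old names. *)
Lemma exec_shift c s t s' : exec c s t s' -> forall S, s = view S ->
  exists2 S', exec (shift c) S t S' & s' = view S'.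
Proof.
elim=> {c s t s'} /=.
- by move=> s S ->; exists S => //; constructor.
- move=> s a i e S ->; rewrite -(icost_sh i) -(icost_sh e) -!ieval_sh; eexists; first exact: ExecSetI.
  by rewrite /view /= update_view.
- move=> s a i e S ->; rewrite -(icost_sh i) -(rcost_sh e) -ieval_sh -reval_sh; eexists; first exact: ExecSetR.
  by rewrite /view /= update_view.
- move=> s s1 s2 t1 t2 c1 c2 _ IH1 _ IH2 S HS.
  have [S1 E1 H1] := IH1 S HS; have [S2 E2 H2] := IH2 S1 H1.
  by exists S2 => //; apply: ExecSeq E1 E2.
- move=> s s1 t b c1 c2 _ IH S HS; have [S1 E1 H1] := IH S HS.
  exists S1 => //; rewrite -bcost_sh; apply: ExecIte.
  by rewrite beval_sh -HS; case: ifP E1.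
- move=> s b c bF S HS; exists S => //; rewrite -bcost_sh; apply: ExecWhileFalse.
  by rewrite beval_sh -HS.
- move=> s s1 s2 t1 t2 b c bT _ IH1 _ IH2 S HS.
  have [S1 E1 H1] := IH1 S HS; have [S2 E2 H2] := IH2 S1 H1.
  exists S2 => //; rewrite -bcost_sh; apply: ExecWhileTrue E1 E2.
  by rewrite beval_sh -HS.
Qed.

End Hoare.

Lemma nowI_shift a c : a < 32 -> nowI a (shift c).
Proof.
move=> Ha; elim: c => //= [a' i e|c1 -> c2 ->|_ c1 -> c2 ->] //.
by apply/eqP => E; move: Ha; rewrite E ltnNge leq_addl.
Qed.

Lemma nowR_shift a c : a < 32 -> nowR a (shift c).
Proof.
move=> Ha; elim: c => //= [a' i e|c1 -> c2 ->|_ c1 -> c2 ->] //.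
by apply/eqP => E; move: Ha; rewrite E ltnNge leq_addl.
Qed.

(** * Koenig's theorem *)

Section Koenig.
Variables (T : finType) (V1 V2 : {set T}) (e : rel T).
Hypothesis V12 : [disjoint V1 & V2].
Hypothesis e_sym : symmetric e.
Hypothesis e_side : forall x y, e x y -> (x \in V1) && (y \in V2) || (x \in V2) && (y \in V1).

Let V12F x : x \in V1 -> x \in V2 -> False.
Proof. by by move=> H1; rewrite (disjointFr V12 H1). Qed.

Definition covered (M : {set {set T}}) (x : T) : bool := [exists y, [set x; y] \in M].

Lemma set2_inj (a b c d : T) : [set a; b] = [set c; d] -> (a = c /\ b = d) \/ (a = d /\ b = c).
Proof.
move=> E; have := in_set2 c a b; rewrite E in_set2 eqxx => /esym/orP[]/eqP Ec.
  have := in_set2 d a b; rewrite E in_set2 eqxx orbT => /esym/orP[]/eqP Ed.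
    have := in_set2 b c d; rewrite -E in_set2 eqxx orbT => /esym/orP[]/eqP; subst; auto.
  by subst; auto.
have := in_set2 d a b; rewrite E in_set2 eqxx orbT => /esym/orP[]/eqP Ed; first by subst; auto.
have := in_set2 a c d; rewrite -E in_set2 eqxx => /esym/orP[]/eqP; subst; auto.
Qed.

Section Matching.
Variable M : {set {set T}}.
Hypothesis matM : is_matching e M.

Lemma matching_edge x y : [set x; y] \in M -> e x y.
Proof.
move=> H; have /imsetP[[a b]] := subsetP matM.1 _ H.
by rewrite inE /= => eab /set2_inj[[-> ->]|[-> ->]] //; rewrite e_sym.
Qed.

Lemma matching_fun x y z : [set x; y] \in M -> [set x; z] \in M -> y = z.
Proof.
move=> Hy Hz; case: (eqVneq [set x; y] [set x; z]) => [E|N].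
  by case: (set2_inj E) => [[]|[-> ->]].
have D := trivIsetP matM.2 _ _ Hy Hz N.
by have := disjointFr D (set21 x y); rewrite set21.
Qed.

Lemma matching_mem A x : A \in M -> x \in A -> exists2 y, A = [set x; y] & e x y.
Proof.
move=> AM; have /imsetP[[a b]] := subsetP matM.1 _ AM; rewrite inE /= => eab ->.
rewrite in_set2 => /orP[]/eqP ->; first by exists b.
by exists a; [apply: setUC|rewrite e_sym].
Qed.

Lemma matching_add x y : e x y -> ~~ covered M x -> ~~ covered M y ->
  is_matching e ([set x; y] |: M) /\ [set x; y] \notin M.
Proof.
move=> exy Nx Ny.
have N : [set x; y] \notin M by apply: contra Nx => H; apply/existsP; exists y.
have disj A : A \in M -> [disjoint [set x; y] & A].
  move=> AM; rewrite disjoint_subset; apply/subsetP => z; rewrite in_set2 inE => /orP[]/eqP->; apply/negP => zA.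
    have [u E _] := matching_mem AM zA; case/negP: Nx.
    by apply/existsP; exists u; rewrite -E.
  have [u E _] := matching_mem AM zA; case/negP: Ny.
  by apply/existsP; exists u; rewrite -E.
split=> //; split.
  apply/subsetP => A; rewrite in_setU1 => /orP[/eqP ->|AM]; last exact: (subsetP matM.1).
  by apply/imsetP; exists (x, y); rewrite ?inE.
apply/trivIsetP => A B; rewrite !in_setU1 => /orP[/eqP->|AM] /orP[/eqP->|BM] NAB.
- by rewrite eqxx in NAB.
- exact: disj.
- by rewrite disjoint_sym; apply: disj.
- exact: (trivIsetP matM.2).
Qed.

End Matching.

Lemma matching_del M A : is_matching e M -> is_matching e (M :\ A).
Proof.
move=> [M1 M2]; split; first by apply: subset_trans M1; apply: subsetDl.
by apply: trivIsetS M2; apply: subsetDl.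
Qed.

(** Two edges of an alternating path at once, so that the paths formed from it stay on one side of
    the bipartition. *)
Definition alt_step (M : {set {set T}}) : rel T :=
  fun a b => [exists v, e a v && ([set v; b] \in M)].

Lemma maximum_matching_card M M' :
  is_maximum_matching e M -> is_matching e M' -> #|M| <= #|M'| -> is_maximum_matching e M'.
Proof. by move=> [_ H] H' le; split=> // M'' /H /leq_trans; apply. Qed.

(* Flipping the first two edges of an alternating path moves the free vertex
   along the path, so a free far end would give a larger matching. *)
Lemma alternating_end_covered p M u v :
  is_maximum_matching e M -> u \in V1 -> ~~ covered M u ->
  path (alt_step M) u p -> uniq (u :: p) -> e (last u p) v -> covered M v.
Proof.
elim: p M u => [|u1 p IH] M u maxM u1V Nu /=.
  move=> _ _ euv; apply: contraT => Nv.
  have [H1 H2] := matching_add maxM.1 euv Nu Nv.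
  by have := maxM.2 _ H1; rewrite cardsU1 H2 ltnn.
move=> /andP[/existsP[v0 /andP[euv0 Mv0]] Hp] /andP[Hu Hu1] ev.
have v0V2 : v0 \in V2.
  by case/orP: (e_side euv0) => /andP[] // uV2; case: (V12F u1V).
have matM := maxM.1.
have eu1 := matching_edge matM Mv0.
have u1V1 : u1 \in V1.
  by case/orP: (e_side eu1) => /andP[] // v0V1; case: (V12F v0V1).
(* The flipped matching has the size of [M], hence is maximum; it leaves [u1] free, and the
   induction hypothesis is applied to it. *)
pose M1 := [set u; v0] |: (M :\ [set v0; u1]).
have matD := matching_del [set v0; u1] matM.
have NuD : ~~ covered (M :\ [set v0; u1]) u.
  apply: contra Nu => /existsP[y]; rewrite in_setD1 => /andP[_ H].
  by apply/existsP; exists y.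
have NvD : ~~ covered (M :\ [set v0; u1]) v0.
  apply/existsP => -[y]; rewrite in_setD1 => /andP[N H].
  by move: N; rewrite (matching_fun matM H Mv0) eqxx.
have [mat1 N1] := matching_add matD euv0 NuD NvD.
have max1 : is_maximum_matching e M1.
  apply: maximum_matching_card maxM mat1 _.
  by rewrite cardsU1 N1 (cardsD1 [set v0; u1] M) Mv0.
have uu1 : u != u1 by apply: contra Hu => /eqP ->; rewrite mem_head.
have C1 : ~~ covered M1 u1.
  apply/existsP => -[y]; rewrite in_setU1 in_setD1 => /orP[/eqP/set2_inj[[E _]|[E _]]|/andP[N H]].
  - by rewrite E eqxx in uu1.
  - by rewrite E in u1V1; case: (V12F u1V1).
  - rewrite setUC in Mv0; move: N; rewrite (matching_fun matM H Mv0).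
    by rewrite setUC eqxx.
have stepV a b : a \in V1 -> alt_step M a b -> b \in V1.
  move=> aV /existsP[w /andP[eaw Mwb]].
  have wV : w \in V2 by case/orP: (e_side eaw) => /andP[] // /(V12F aV).
  by case/orP: (e_side (matching_edge matM Mwb)) => /andP[] // /V12F/(_ wV).
have pathV q x : x \in V1 -> path (alt_step M) x q -> last x q \in V1.
  by elim: q x => //= y q IHq x xV /andP[/(stepV _ _ xV)]; apply: IHq.
(* The rest of the path survives the flip: the only removed matching edge ends in [u1], which a
   simple path does not visit again. *)
have path1 (q : seq T) x : x \in V1 -> u1 \notin q -> path (alt_step M) x q -> path (alt_step M1) x q.
  elim: q x => //= y q IHq x xV; rewrite inE negb_or => /andP[Ny Nq] /andP[Sx Sq].
  rewrite IHq ?(stepV _ _ xV Sx) // andbT.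
  case/existsP: Sx => w /andP[exw Mwy]; apply/existsP; exists w.
  rewrite exw in_setU1 in_setD1 Mwy andbT; apply/orP; right; apply/eqP => /set2_inj[[_ E]|[E _]].
    by rewrite E eqxx in Ny.
  case/orP: (e_side exw) => /andP[H1 H2]; last exact: (V12F xV).
  by rewrite E in H2; apply: V12F u1V1 H2.
have U1 : uniq (u1 :: p) by rewrite /= Hu1.
have /existsP[b] := IH M1 u1 max1 u1V1 C1 (path1 _ _ u1V1 (andP Hu1).1 Hp) U1 ev.
rewrite in_setU1 in_setD1 => /orP[/eqP/set2_inj[[E1 E2]|[E1 E2]]|/andP[_ H]].
- have lV := pathV _ _ u1V1 Hp.
  case/orP: (e_side ev) => /andP[H1 H2]; last by case: (V12F lV H1).
  by rewrite E1 in H2; case: (V12F u1V H2).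
- by apply/existsP; exists u1; rewrite E1.
- by apply/existsP; exists b.
Qed.

Definition partner (M : {set {set T}}) (x : T) : T := odflt x [pick y | [set x; y] \in M].

Lemma partnerP M x : covered M x -> [set x; partner M x] \in M.
Proof. by rewrite /partner => /existsP[y Hy]; case: pickP => [//|/(_ y)]; rewrite Hy. Qed.

Lemma partner_inj M : is_matching e M -> {in covered M &, injective (partner M)}.
Proof.
move=> matM x y /partnerP Hx /partnerP Hy E; rewrite -E setUC in Hy; rewrite setUC in Hx.
exact: (matching_fun matM Hx Hy).
Qed.

Definition exposed (M : {set {set T}}) := [set x in V1 | ~~ covered M x].

(** A covered vertex of [I] in [V1] has its partner in [V2] but outside [I], and partners are
    distinct. So these vertices fit into [V2 :\: I], and the other vertices of [I] in [V1] are
    exposed. *)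
Lemma independent_card_le M (I : {set T}) : is_matching e M ->
  I \subset V1 :|: V2 -> {in I &, forall x y, ~~ e x y} -> #|I| <= #|V2| + #|exposed M|.
Proof.
move=> matM IV indI.
have E : I = (I :&: V2) :|: (I :&: exposed M) :|: [set x in I :&: V1 | covered M x].
  apply/setP => x; rewrite !inE; case xI: (x \in I) => //=.
  by have := subsetP IV x xI; rewrite in_setU => /orP[]->; case: covered; rewrite ?orbT ?andbT.
have C : #|[set x in I :&: V1 | covered M x]| <= #|V2 :\: I|.
  rewrite -(@card_in_imset _ _ (partner M)); last first.
    move=> x y; rewrite !inE => /andP[_ Hx] /andP[_ Hy]; exact: partner_inj.
  apply/subset_leq_card/subsetP => _ /imsetP[x + ->]; rewrite !inE => /andP[/andP[xI xV] /partnerP Hx].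
  have ex := matching_edge matM Hx; apply/andP; split.
    by apply/negP => H; have := indI _ _ xI H; rewrite ex.
  by case/orP: (e_side ex) => /andP[] // H; case: (V12F xV H).
rewrite E (leq_trans (leq_card_setU _ _)) //.
apply: (leq_trans (leq_add (leq_card_setU _ _) C)).
rewrite addnAC -(cardsID I V2) setIC leq_add2l.
by apply: subset_leq_card; apply: subsetIr.
Qed.

Lemma independent_card_max M : is_maximum_matching e M ->
  exists I : {set T}, [/\ I \subset V1 :|: V2, {in I &, forall x y, ~~ e x y} &
    #|V2| + #|exposed M| <= #|I|].
Proof.
move=> maxM; have matM := maxM.1.
(* [Z] is what alternating paths reach from the exposed vertices and [N] is its neighbourhood. The
   independent set is [Z] together with [V2 :\: N]. *)
pose Z := [set z in V1 | [exists u in exposed M, connect (alt_step M) u z]].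
pose N := [set v | [exists z in Z, e z v]].
have NV v : v \in N -> v \in V2.
  rewrite inE => /existsP[z]; rewrite !inE => /andP[/andP[zV _] /e_side/orP[]/andP[] // zV2].
  by case: (V12F zV zV2).
have Nc v : v \in N -> covered M v.
  rewrite inE => /existsP[z]; rewrite !inE => /andP[/andP[zV /existsP[u /andP[]]]].
  rewrite inE => /andP[uV Cu] /connectP[p Hp Ez] ezv.
  move: Ez ezv; case: (shortenP Hp) => q Hq Uq _ ->.
  exact: (alternating_end_covered maxM uV Cu Hq Uq).
have fZ : exposed M \subset Z.
  apply/subsetP => x xf; rewrite inE; have := xf; rewrite inE => /andP[-> _] /=.
  by apply/existsP; exists x; rewrite xf connect0.
(* By maximality every vertex of [N] is covered; its partner is again reachable, and is not
   exposed. *)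
have CN : #|N| <= #|Z :\: exposed M|.
  rewrite -(@card_in_imset _ _ (partner M) (mem N)); last first.
    by move=> x y /Nc Hx /Nc Hy; apply: partner_inj.
  apply/subset_leq_card/subsetP => _ /imsetP[v vN ->].
  have H := partnerP (Nc _ vN); have ev := matching_edge matM H.
  have cp : covered M (partner M v) by apply/existsP; exists v; rewrite setUC.
  rewrite in_setD !inE cp andbF /=.
  have pV : partner M v \in V1.
    by case/orP: (e_side ev) => /andP[] // H1; case: (V12F H1 (NV _ vN)).
  rewrite pV /=; move: vN; rewrite inE => /existsP[z]; rewrite !inE => /andP[/andP[zV /existsP[u /andP[uf cz]]] ezv].
  apply/existsP; exists u; rewrite uf; apply: connect_trans cz _; apply: connect1.
  by apply/existsP; exists v; rewrite ezv.
exists (Z :|: (V2 :\: N)); split.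
- apply: setUSS; last exact: subsetDl.
  by apply/subsetP => x; rewrite inE => /andP[].
- have aux x y : x \in Z -> y \in Z :|: (V2 :\: N) -> ~~ e x y.
    move=> xZ; rewrite in_setU in_setD => /orP[yZ|/andP[+ _]]; last first.
      by apply: contra => exy; rewrite inE; apply/existsP; exists x; rewrite xZ.
    move: xZ yZ; rewrite !inE => /andP[xV _] /andP[yV _]; apply/negP => /e_side.
    by case/orP=> /andP[]; [move=> _; apply: V12F|move/(V12F xV)].
  move=> x y; rewrite [x \in _]in_setU => /orP[xZ|xV]; first exact: aux.
  move=> yI; case/setUP: (yI) => [yZ|yV].
    by rewrite e_sym; apply: aux => //; rewrite in_setU xV orbT.
  move: xV yV; rewrite !in_setD => /andP[_ xV] /andP[_ yV]; apply/negP => /e_side.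
  by case/orP=> /andP[H1 H2]; [apply: (V12F H1 xV)|apply: (V12F H2 yV)].
- rewrite cardsU; have -> : Z :&: (V2 :\: N) = set0.
    apply/setP => x; rewrite !inE; apply/negP => /andP[/andP[xV _] /andP[_ xV2]].
    exact: V12F xV xV2.
  rewrite cards0 subn0 -(cardsID (exposed M) Z) (setIidPr fZ).
  have NV' : N \subset V2 by apply/subsetP.
  rewrite -(cardsID N V2) (setIidPr NV'); lia.
Qed.

End Koenig.

(** * Geometry of a guess *)

Section Geometry.
Variable R : realType.
Local Open Scope ring_scope.
Implicit Types (u v w : nat -> R).

(* Vectors of R^3 are functions on nat, read at 0, 1 and 2 only. *)
Definition dotv (a b : nat -> R) : R := a 0%N * b 0%N + a 1%N * b 1%N + a 2%N * b 2%N.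
Definition subv (a b : nat -> R) : nat -> R := fun l => a l - b l.
Definition crossv (a b : nat -> R) : nat -> R := fun l =>
  match l with
  | 0%N => a 1%N * b 2%N - a 2%N * b 1%N
  | 1%N => a 2%N * b 0%N - a 0%N * b 2%N
  | _ => a 0%N * b 1%N - a 1%N * b 0%N
  end.

(** * Points above and below the segment of their class *)

Definition sqd (a b : nat -> R) : R := dotv (subv a b) (subv a b).

Lemma dotv_ge0 (a : nat -> R) : 0 <= dotv a a.
Proof. by rewrite /dotv -!expr2 !addr_ge0 ?sqr_ge0. Qed.

Lemma dotv_eq0 (a : nat -> R) : dotv a a = 0 -> [/\ a 0%N = 0, a 1%N = 0 & a 2%N = 0].
Proof.
rewrite /dotv -!expr2 => /eqP.
rewrite !paddr_eq0 ?addr_ge0 ?sqr_ge0 // !sqrf_eq0 => /andP[/andP[/eqP ? /eqP ?] /eqP ?].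
by [].
Qed.

Lemma dotv_gt0 (a : nat -> R) : (exists2 l, (l < 3)%N & a l != 0) -> 0 < dotv a a.
Proof.
move=> [l l3 al]; rewrite lt0r dotv_ge0 andbT; apply/eqP => /dotv_eq0[a0 a1 a2].
by case: l l3 al => [|[|[|]]] //; rewrite ?a0 ?a1 ?a2 eqxx.
Qed.

Lemma sqdC (a b : nat -> R) : sqd a b = sqd b a.
Proof. by rewrite /sqd /dotv /subv; ring. Qed.

(** The vectors [w], [N = w x v] and [N x w] form an orthogonal basis. [E] is the expansion of [d]
    in it, with denominators cleared, and only the component along [w] is left. *)
Lemma parallel_of_orthogonal w v d l : (l < 3)%N -> 0 < dotv (crossv w v) (crossv w v) ->
  dotv (crossv w v) d = 0 -> dotv (crossv (crossv w v) w) d = 0 ->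
  d l = dotv w d / dotv w w * w l.
Proof.
move=> l3 Npos H1 H2.
have Wpos : 0 < dotv w w.
  rewrite lt0r dotv_ge0 andbT; apply/eqP => /dotv_eq0[w0 w1 w2].
  by move: Npos; rewrite /dotv /crossv w0 w1 w2; lra.
have E : dotv w w * dotv (crossv w v) (crossv w v) * d l =
   dotv (crossv w v) (crossv w v) * dotv w d * w l +
   dotv w w * dotv (crossv w v) d * crossv w v l +
   dotv (crossv (crossv w v) w) d * crossv (crossv w v) w l.
  by case: l l3 => [|[|[|]]] // _; rewrite /dotv /crossv; ring.
rewrite H1 H2 mulr0 !mul0r !addr0 in E.
apply: (mulfI (lt0r_neq0 Npos)); apply: (mulfI (lt0r_neq0 Wpos)).
rewrite mulrA E; field; exact: lt0r_neq0.
Qed.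

(** The first conjunct says without division that the point is on or above the line through the two
    ends. When the ends have the same abscissa as the point it is void, and the second conjunct
    compares with the left end instead. *)
Definition upper (xl xr xv yl yr yv : R) : bool :=
  ((xv - xl) * (yr - yl) <= (xr - xl) * (yv - yl)) && ((xl < xr) || (yl <= yv)).

(** The three points have equal height along [N], and [X] orders the plane orthogonally to [w]. So
    [u] sits over a point of the segment from [p] to [q], at signed distance proportional to [t]
    along [w]. *)
Lemma segment_decomposition w v (u p q : nat -> R) :
  let N := crossv w v in let X := crossv N w in
  0 < dotv N N -> dotv N p = dotv N u -> dotv N q = dotv N u ->
  dotv X p <= dotv X u -> dotv X u <= dotv X q ->
  exists la t : R, [/\ 0 <= la <= 1,
    forall l, (l < 3)%N -> u l = (1 - la) * p l + la * q l + t * w l &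
    if upper (dotv X p) (dotv X q) (dotv X u) (dotv w p) (dotv w q) (dotv w u)
    then 0 <= t else t <= 0].
Proof.
move=> N X Npos Np Nq Xp Xq.
have Wpos : 0 < dotv w w.
  rewrite lt0r dotv_ge0 andbT; apply/eqP => /dotv_eq0[w0 w1 w2].
  by move: Npos; rewrite /N /dotv /crossv w0 w1 w2; lra.
have main la : dotv X u = (1 - la) * dotv X p + la * dotv X q ->
   forall l, (l < 3)%N -> u l = (1 - la) * p l + la * q l +
     (dotv w u - ((1 - la) * dotv w p + la * dotv w q)) / dotv w w * w l.
  move=> EX l l3; pose d l := u l - ((1 - la) * p l + la * q l).
  have := @parallel_of_orthogonal w v d l l3 Npos.
  have lin a : dotv a d = dotv a u - ((1 - la) * dotv a p + la * dotv a q).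
    by rewrite /dotv /d; ring.
  rewrite -/N -/X !lin EX Np Nq.
  have -> : dotv N u - ((1 - la) * dotv N u + la * dotv N u) = 0 by ring.
  rewrite subrr => /(_ erefl erefl) Ed.
  by rewrite -Ed /d; ring.
rewrite /upper; case: (ltrP (dotv X p) (dotv X q)) => Hpq /=.
  have Dpos : 0 < dotv X q - dotv X p by rewrite subr_gt0.
  set la := (dotv X u - dotv X p) / (dotv X q - dotv X p).
  have EX : dotv X u = (1 - la) * dotv X p + la * dotv X q.
    by rewrite /la; field; exact: lt0r_neq0.
  exists la; eexists; split; [|exact: (main la EX)|].
    apply/andP; split; first by rewrite divr_ge0 ?subr_ge0 // ltW.
    by rewrite ler_pdivrMr // mul1r; lra.
  have Elam : la * (dotv X q - dotv X p) = dotv X u - dotv X p.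
    by rewrite /la divfK // lt0r_neq0.
  rewrite andbT -Elam.
  have -> : la * (dotv X q - dotv X p) * (dotv w q - dotv w p) =
     (dotv X q - dotv X p) * (la * (dotv w q - dotv w p)) by ring.
  rewrite ler_pM2l //.
  case: ifP => H.
    by apply: divr_ge0; [move: H; lra|exact: ltW].
  rewrite ler_pdivrMr // mul0r; move/negbT: H; rewrite -ltNge; lra.
(* Here the ends and [u] all have the same coordinate along [X], and [p] serves as the foot
   point. *)
have EX : dotv X u = (1 - 0) * dotv X p + 0 * dotv X q by lra.
exists 0; eexists; split; [by rewrite lexx ler01|exact: (main 0 EX)|].
have E1 : dotv X u - dotv X p = 0 by lra.
have E2 : dotv X q - dotv X p = 0 by lra.
rewrite E1 E2 !mul0r lexx /= addr0 subr0 mul1r.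
case: ifP => H; first by apply: divr_ge0; [rewrite subr_ge0|exact: ltW].
by rewrite ler_pdivrMr // mul0r subr_le0 leNgt; move: H => /negbT; rewrite -ltNge => /ltW; rewrite -leNgt.
Qed.

(** Convexity of the squared distance, obtained from Stewart's identity [E]. *)
Lemma sqd_segment (u p q z : nat -> R) (la D : R) : 0 <= la <= 1 ->
  (forall l, (l < 3)%N -> z l = (1 - la) * p l + la * q l) ->
  sqd u p <= D -> sqd u q <= D -> sqd u z <= D.
Proof.
move=> /andP[l0 l1] Hz Hp Hq.
have E : sqd u z = (1 - la) * sqd u p + la * sqd u q - la * (1 - la) * sqd p q.
  by rewrite /sqd /dotv /subv !Hz //; ring.
have H1 : 0 <= la * (1 - la) * sqd p q.
  by rewrite mulr_ge0 ?dotv_ge0 // mulr_ge0 // subr_ge0.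
have H2 : (1 - la) * sqd u p <= (1 - la) * D by rewrite ler_wpM2l // subr_ge0.
have H3 : la * sqd u q <= la * D by rewrite ler_wpM2l.
rewrite E; lra.
Qed.

(* If w.(u - v) >= 0, moving v back down to the segment only increases its
   distance from u; otherwise exchange the roles of u and v. *)
Lemma sqd_same_side (u v u' v' w : nat -> R) (a b D : R) :
  0 <= a -> 0 <= b ->
  (forall l, (l < 3)%N -> u l = u' l + a * w l) ->
  (forall l, (l < 3)%N -> v l = v' l + b * w l) ->
  sqd u v' <= D -> sqd v u' <= D -> sqd u v <= D.
Proof.
move=> a0 b0 Hu Hv H1 H2.
have E1 : sqd u v' = sqd u v + 2 * (b * dotv w (subv u v)) + b ^+ 2 * dotv w w.
  by rewrite /sqd /dotv /subv !Hv //; ring.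
have E2 : sqd v u' = sqd u v - 2 * (a * dotv w (subv u v)) + a ^+ 2 * dotv w w.
  by rewrite /sqd /dotv /subv !Hu //; ring.
have P1 : 0 <= b ^+ 2 * dotv w w by rewrite mulr_ge0 ?sqr_ge0 ?dotv_ge0.
have P2 : 0 <= a ^+ 2 * dotv w w by rewrite mulr_ge0 ?sqr_ge0 ?dotv_ge0.
case: (lerP 0 (dotv w (subv u v))) => H.
  have : 0 <= b * dotv w (subv u v) by rewrite mulr_ge0.
  lra.
have : a * dotv w (subv u v) <= 0 by rewrite mulr_ge0_le0 // ltW.
lra.
Qed.

(** Each point is close to both ends of the segment of the other, hence by convexity to the foot
    point of the other; [sqd_same_side] then applies, with [w] negated if both points lie below. *)
Lemma guess_same_side w v (u1 p1 q1 u2 p2 q2 : nat -> R) (D : R) :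
  let N := crossv w v in let X := crossv N w in
  let up u p q := upper (dotv X p) (dotv X q) (dotv X u) (dotv w p) (dotv w q) (dotv w u) in
  0 < dotv N N ->
  dotv N p1 = dotv N u1 -> dotv N q1 = dotv N u1 ->
  dotv X p1 <= dotv X u1 -> dotv X u1 <= dotv X q1 ->
  dotv N p2 = dotv N u2 -> dotv N q2 = dotv N u2 ->
  dotv X p2 <= dotv X u2 -> dotv X u2 <= dotv X q2 ->
  sqd u1 p2 <= D -> sqd u1 q2 <= D -> sqd u2 p1 <= D -> sqd u2 q1 <= D ->
  up u1 p1 q1 = up u2 p2 q2 -> sqd u1 u2 <= D.
Proof.
move=> N X up Npos a1 a2 a3 a4 b1 b2 b3 b4 d1 d2 d3 d4 E.
have [la [s [la01 Hs Us]]] := segment_decomposition Npos a1 a2 a3 a4.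
have [mu [t [mu01 Ht Ut]]] := segment_decomposition Npos b1 b2 b3 b4.
pose z1 l := (1 - la) * p1 l + la * q1 l; pose z2 l := (1 - mu) * p2 l + mu * q2 l.
have e1 : sqd u1 z2 <= D by apply: (sqd_segment mu01 _ d1 d2).
have e2 : sqd u2 z1 <= D by apply: (sqd_segment la01 _ d3 d4).
move: Us Ut; rewrite -/N -/X -/(up u1 p1 q1) -/(up u2 p2 q2) E; case: ifP => _ Us Ut.
  exact: (sqd_same_side Us Ut Hs Ht e1 e2).
rewrite -oppr_ge0 in Us; rewrite -oppr_ge0 in Ut.
apply: (@sqd_same_side u1 u2 z1 z2 (fun l => - w l) _ _ _ Us Ut) => // l l3.
  by rewrite mulrNN Hs.
by rewrite mulrNN Ht.
Qed.

(** * Candidate frames *)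

Section Candidates.
Variables (P : nat -> nat -> R) (n : nat).

Definition pt (i : nat) : nat -> R := fun l => P l i.

(* A candidate c spans its planes by the vectors pt (c 1) - pt (c 0) and
   pt (c 3) - pt (c 2). *)
Definition wvec (c : nat -> nat) := subv (pt (c 1%N)) (pt (c 0%N)).
Definition vvec (c : nat -> nat) := subv (pt (c 3%N)) (pt (c 2%N)).
Definition nvec c := crossv (wvec c) (vvec c).
Definition xvec c := crossv (nvec c) (wvec c).

(** The differences of the virtual points from point 0 are the unit vectors, so a candidate given by
    four indices can also use these as frame vectors. *)
Definition virtual_points := forall l t, (l < 3)%N -> (t < 3)%N ->
  P l (n + t)%N = P l 0%N + (l == t)%:R.

Hypothesis HP : virtual_points.
Hypothesis n0 : (0 < n)%N.

Definition cand4 (p q s t : nat) : nat -> nat := fun j => nth 0%N [:: p; q; s; t] j.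

Lemma crossv_unit_neq0 w : 0 < dotv w w ->
  exists2 t, (t < 3)%N & 0 < dotv (crossv w (subv (pt (n + t)) (pt 0)))
                                  (crossv w (subv (pt (n + t)) (pt 0))).
Proof.
move=> Wpos; have [/eqP w0|w0] := boolP (w 0%N == 0); last first.
  exists 1%N => //; apply: dotv_gt0; exists 2%N => //.
  by rewrite /crossv /subv /pt !HP //=; apply: contra w0 => /eqP H; apply/eqP; lra.
have [/eqP w1|w1] := boolP (w 1%N == 0); last first.
  exists 2%N => //; apply: dotv_gt0; exists 0%N => //.
  by rewrite /crossv /subv /pt !HP //=; apply: contra w1 => /eqP H; apply/eqP; lra.
have [/eqP w2|w2] := boolP (w 2%N == 0); last first.
  exists 0%N => //; apply: dotv_gt0; exists 1%N => //.
  by rewrite /crossv /subv /pt !HP //=; apply: contra w2 => /eqP H; apply/eqP; lra.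
by move: Wpos; rewrite /dotv w0 w1 w2; lra.
Qed.

(** [G] holds the differences allowed as frame vectors and [D] the pairs that must get equal height.
    Each difference from [D] is one of [G] minus another, so the normal only has to be orthogonal to
    [G]. The cases are: two independent vectors in [G]; a nonzero one but no two independent,
    completed by a unit vector; only zero vectors. *)
Lemma exists_candidate (u : nat -> R) (G D : nat -> nat -> Prop) :
  0 < dotv u u ->
  (forall p q, G p q -> [/\ (p < n)%N, (q < n)%N & dotv u (subv (pt q) (pt p)) = 0]) ->
  (forall a b, D a b -> exists p1 q1 p2 q2, [/\ G p1 q1, G p2 q2 &
     forall l, (l < 3)%N -> subv (pt b) (pt a) l = subv (pt q1) (pt p1) l - subv (pt q2) (pt p2) l]) ->
  exists c : nat -> nat, [/\ forall j, (j < 4)%N -> (c j < n + 3)%N,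
    0 < dotv (nvec c) (nvec c),
    forall a b, D a b -> dotv (nvec c) (pt a) = dotv (nvec c) (pt b) &
    (c 0%N = 0%N \/ G (c 0%N) (c 1%N)) /\ (c 2%N = 0%N \/ G (c 2%N) (c 3%N))].
Proof.
move=> Upos HG HD.
have reduce c : (forall p q, G p q -> dotv (nvec c) (subv (pt q) (pt p)) = 0) ->
    forall a b, D a b -> dotv (nvec c) (pt a) = dotv (nvec c) (pt b).
  move=> H a b /HD[p1 [q1 [p2 [q2 [g1 g2 E]]]]].
  apply/eqP; rewrite eq_sym -subr_eq0.
  have -> : dotv (nvec c) (pt b) - dotv (nvec c) (pt a) = dotv (nvec c) (subv (pt b) (pt a)).
    by rewrite /dotv /subv; ring.
  have -> : dotv (nvec c) (subv (pt b) (pt a)) =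
     dotv (nvec c) (subv (pt q1) (pt p1)) - dotv (nvec c) (subv (pt q2) (pt p2)).
    by rewrite {1}/dotv !E // /dotv; ring.
  by rewrite !H // subrr.
case: (pselect (exists p q s t, [/\ G p q, G s t &
    0 < dotv (nvec (cand4 p q s t)) (nvec (cand4 p q s t))])) => [[p [q [s [t [Gpq Gst Npos]]]]]|NA].
  have [p1 q1 u1] := HG _ _ Gpq; have [s1 t1 u2] := HG _ _ Gst.
  exists (cand4 p q s t); split=> //; last by split; right.
    by case=> [|[|[|[|]]]] //= _; rewrite (leq_trans _ (leq_addr _ _)).
  apply: reduce => p' q' Gpq'; have [_ _ u3] := HG _ _ Gpq'.
  set c := cand4 p q s t; set d := subv _ _.
  (* Vectors [w], [v], [d] orthogonal to a nonzero [u] have zero triple product: this identity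
     expresses its product with [u] through their dot products with [u]. *)
  have E l : (l < 3)%N -> dotv (nvec c) d * u l = dotv u (wvec c) * crossv (vvec c) d l
     + dotv u (vvec c) * crossv d (wvec c) l + dotv u d * nvec c l.
    by case: l => [|[|[|]]] // _; rewrite /nvec /dotv /crossv; ring.
  rewrite /wvec /vvec /= u1 u2 u3 in E.
  apply/eqP; apply: contraT => Nd.
  have Z l : (l < 3)%N -> u l = 0.
    by move=> l3; apply: (mulfI Nd); rewrite E // mulr0 !mul0r !addr0.
  by move: Upos; rewrite /dotv !Z // !mulr0 !addr0 ltxx.
have par p q s t : G p q -> G s t -> forall l, (l < 3)%N -> nvec (cand4 p q s t) l = 0.
  move=> g1 g2 l l3; apply/eqP; apply: contraT => Nl; case: NA.
  by exists p, q, s, t; split=> //; apply: dotv_gt0; exists l.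
case: (pselect (exists p q, G p q /\ 0 < dotv (subv (pt q) (pt p)) (subv (pt q) (pt p)))) => [[p [q [Gpq Wpos]]]|NB].
  have [p1 q1 _] := HG _ _ Gpq; have [t t3 Npos] := crossv_unit_neq0 Wpos.
  exists (cand4 p q 0%N (n + t)%N); split=> //; last by split; [right|left].
    case=> [|[|[|[|]]]] //= _; rewrite ?ltn_add2l ?addn_gt0 ?n0 //.
      by rewrite (leq_trans p1) // leq_addr.
    by rewrite (leq_trans q1) // leq_addr.
  apply: reduce => p' q' Gpq'.
  have Z := par _ _ _ _ Gpq Gpq'.
  rewrite /nvec /wvec /vvec /=; set w := subv (pt q) _; set v := subv _ _; set d := subv _ _.
  (* Exchanging two factors of the triple product leads to [w x d], which vanishes because [d] is
     parallel to [w]. *)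
  have -> : dotv (crossv w v) d = - dotv (nvec (cand4 p q p' q')) v.
    by rewrite /nvec /wvec /vvec /= -/w -/d /dotv /crossv; ring.
  by rewrite /dotv !Z // !mul0r !addr0 oppr0.
exists (cand4 0%N n 0%N n.+1); split.
- by case=> [|[|[|[|]]]] // _; rewrite /cand4 /=; lia.
- apply: dotv_gt0; exists 2%N => //.
  rewrite /nvec /wvec /vvec /= /subv /pt -[n.+1]addn1 -[X in P _ X](addn0 n) !HP //=.
  by rewrite (_ : _ - _ = 1) ?oner_neq0 //; ring.
- apply: reduce => p q Gpq; have [Z0 Z1 Z2] : [/\ subv (pt q) (pt p) 0%N = 0, subv (pt q) (pt p) 1%N = 0 & subv (pt q) (pt p) 2%N = 0].
    apply: dotv_eq0; apply/eqP; apply: contraT => H; case: NB; exists p, q; split=> //.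
    by rewrite lt0r H dotv_ge0.
  by rewrite /dotv Z0 Z1 Z2 !mulr0 !addr0.
- by split; left.
Qed.

(** * Classes of centers with equal height and radius *)

Variable rad : nat -> R.

Definition hN c i := dotv (nvec c) (pt i).
Definition hX c i := dotv (xvec c) (pt i).
Definition hY c i := dotv (wvec c) (pt i).

Definition same c i j := (hN c i == hN c j) && (rad i == rad j).
(** A class is counted at its member of least index. *)
Definition newb c i := ~~ has (same c i) (iota 0 i).
Definition ncl c := count (newb c) (iota 0 n).

Lemma ncl_le c (idx : nat -> nat) m : (forall i, (i < n)%N -> (idx i < m)%N) ->
  (forall i j, (i < n)%N -> (j < n)%N -> idx i = idx j -> same c i j) -> (ncl c <= m)%N.
Proof.
move=> Hm Hs; rewrite /ncl -size_filter -(size_map idx) -[m in (_ <= m)%N](size_iota 0).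
apply: uniq_leq_size.
  rewrite map_inj_in_uniq ?filter_uniq ?iota_uniq // => i j.
  rewrite !mem_filter !mem_iota !add0n /= => /andP[Ni i1] /andP[Nj j1] E.
  case: (ltngtP i j) => // H.
    case/hasP: Nj; exists i; first by rewrite mem_iota.
    exact: Hs.
  case/hasP: Ni; exists j; first by rewrite mem_iota.
  exact: Hs.
move=> x /mapP[i]; rewrite mem_filter mem_iota add0n => /andP[_ H] ->.
by rewrite mem_iota /= add0n Hm.
Qed.

Lemma ncl_gt0 c : (0 < ncl c)%N.
Proof.
rewrite /ncl -has_count; apply/hasP; exists 0%N => //.
by rewrite mem_iota.
Qed.

Lemma ncl_leq_n c : (ncl c <= n)%N.
Proof. by rewrite /ncl -[n in (_ <= n)%N](size_iota 0); apply: count_size. Qed.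

End Candidates.
End Geometry.

(** * Evaluating a candidate *)

Notation K c := (IConst c).
Notation V a := (IGet a (IConst 0)).

Definition BEqR (x y : rexp) := BAnd (BLeR x y) (BLeR y x).
Definition BEqI (x y : iexp) := BAnd (BLeI x y) (BLeI y x).
Definition BOr (x y : bexp) := BNot (BAnd (BNot x) (BNot y)).

Definition VSub (dst a b : nat) : com :=
  let f l := SetR dst (K l) (RSub (RGet l (IGet 21 (K a))) (RGet l (IGet 21 (K b)))) in
  Seq (f 0) (Seq (f 1) (f 2)).

Definition VCross (dst a b : nat) : com :=
  let f k i j := SetR dst (K k) (RSub (RMul (RGet a (K i)) (RGet b (K j)))
                                      (RMul (RGet a (K j)) (RGet b (K i)))) in
  Seq (f 0 1 2) (Seq (f 1 2 0) (f 2 0 1)).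

Definition Dot (a : nat) (i : iexp) : rexp :=
  let f l := RMul (RGet a (K l)) (RGet l i) in
  RAdd (RAdd (f 0) (f 1)) (f 2).

(* Integer arrays: 0 the number n of balls, 3 and 4 loop counters, 6 the number
   of classes, 7 the class of each ball, 21 the candidate.  Real arrays: 0 to 2
   the coordinates, 3 the radii, 4 to 7 the vectors wvec, vvec, nvec and xvec,
   8 to 10 the scalars hN, hX and hY of each ball. *)
Definition Heights : com :=
  Seq (VSub 4 1 0) (Seq (VSub 5 3 2) (Seq (VCross 6 4 5) (Seq (VCross 7 6 4)
  (For 3 (V 0) (Seq (SetR 8 (V 3) (Dot 6 (V 3)))
               (Seq (SetR 9 (V 3) (Dot 7 (V 3))) (SetR 10 (V 3) (Dot 4 (V 3))))))))).

Definition SameTest : bexp :=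
  BAnd (BEqR (RGet 8 (V 3)) (RGet 8 (V 4))) (BEqR (RGet 3 (V 3)) (RGet 3 (V 4))).

(** Each ball first takes the fresh number in array 6 and gives it up for the number of an
    equivalent earlier ball. Earlier numbers are below the fresh one, so the final comparison tells
    whether a class was opened. *)
Definition Classes : com :=
  Seq (SetI 6 (K 0) (K 0))
  (For 3 (V 0)
    (Seq (SetI 7 (V 3) (V 6))
    (Seq (For 4 (V 3) (Ite SameTest (SetI 7 (V 3) (IGet 7 (V 4))) Skip))
         (Ite (BLeI (V 6) (IGet 7 (V 3))) (SetI 6 (K 0) (IAdd (V 6) (K 1))) Skip)))).

Definition EvalN : com := Seq Heights Classes.

Section EvalNSpec.
Variables (R : realType) (n : nat) (P : nat -> nat -> R) (rad : nat -> R).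
Implicit Types s : state R.
Hypothesis n0 : 0 < n.

Definition env s : Prop :=
  [/\ ints s 0 0 = n, forall l x, l < 3 -> x < n + 3 -> reals s l x = P l x &
      forall x, x < n -> reals s 3 x = rad x].

Lemma env_eq s s' : env s -> ints s' 0 = ints s 0 ->
  (forall l, l < 4 -> reals s' l = reals s l) -> env s'.
Proof.
move=> [E0 EP Er] H0 Hl; split; first by rewrite H0.
  by move=> l x l3 xn; rewrite Hl ?EP // (leq_trans l3).
by move=> x xn; rewrite Hl // Er.
Qed.

Lemma env_frame c s s' : env s -> frame c s s' -> nowI 0 c ->
  all (fun l => nowR l c) (iota 0 4) -> env s'.
Proof.
move=> Es [F G] N0 Nl; apply: (env_eq Es); first exact: F.
by move=> l l4; apply/G/(allP Nl); rewrite mem_iota.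
Qed.

Definition heights (c : nat -> nat) s : Prop :=
  (forall l, l < 3 -> reals s 6 l = nvec P c l) /\
  (forall i, i < n -> [/\ reals s 8 i = hN P c i, reals s 9 i = hX P c i & reals s 10 i = hY P c i]).

Definition classes (c : nat -> nat) s : Prop :=
  [/\ ints s 6 0 = ncl P n rad c,
      forall i j, i < n -> j < n -> (ints s 7 i == ints s 7 j) = same P rad c i j &
      forall i, i < n -> ints s 7 i < ncl P n rad c].

Lemma hw_vcross dst a b s : dst != a -> dst != b ->
  halts_within (VCross dst a b) s 40 (fun s' =>
    forall l, l < 3 -> reals s' dst l = crossv (reals s a) (reals s b) l).
Proof.
move=> Na Nb; apply: hw_ev => //.
have [Na' Nb'] : a != dst /\ b != dst by rewrite ![_ == dst]eq_sym.
by case=> [|[|[|]]] // _; rewrite /= /update /= ?eqxx ?(negbTE Na') ?(negbTE Nb').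
Qed.

Lemma hw_vsub dst a b c s : 3 < dst -> env s ->
  (forall j, j < 4 -> ints s 21 j = c j /\ c j < n + 3) -> a < 4 -> b < 4 ->
  halts_within (VSub dst a b) s 40 (fun s' =>
    forall l, l < 3 -> reals s' dst l = subv (pt P (c a)) (pt P (c b)) l).
Proof.
move=> d3 [E0 EP Er] Hc a4 b4; apply: hw_ev => //.
have [Ea ca] := Hc _ a4; have [Eb cb] := Hc _ b4.
have D l : l < 3 -> (l == dst) = false by move=> l3; apply/eqP; lia.
by case=> [|[|[|]]] // _; rewrite /= /update /= ?eqxx ?D //= /subv /pt Ea Eb !EP.
Qed.

Lemma crossv_ext (a b a' b' : nat -> R) : (forall l, l < 3 -> a l = a' l) ->
  (forall l, l < 3 -> b l = b' l) -> forall l, l < 3 -> crossv a b l = crossv a' b' l.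
Proof. by move=> Ha Hb [|[|[|]]] // _; rewrite /crossv !Ha // !Hb. Qed.

Lemma hw_heights c s : env s ->
  (forall j, j < 4 -> ints s 21 j = c j /\ c j < n + 3) ->
  halts_within Heights s (n * 85 + 180) (heights c).
Proof.
move=> Es Hc.
apply: (@hw_seq _ _ _ _ 40 (n * 85 + 140)); last by lia.
apply: hw_weak (hw_vsub (dst := 4) _ Es Hc (a := 1) (b := 0) _ _) _ _ => // s1 F1 H1 _.
have E1 := env_frame Es F1 isT isT.
have Hc1 j : j < 4 -> ints s1 21 j = c j /\ c j < n + 3 by rewrite (F1.1 21 isT); apply: Hc.
apply: (@hw_seq _ _ _ _ 40 (n * 85 + 100)); last by lia.
apply: hw_weak (hw_vsub (dst := 5) _ E1 Hc1 (a := 3) (b := 2) _ _) _ _ => // s2 F2 H2 _.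
have E2 := env_frame E1 F2 isT isT.
have H12 l : l < 3 -> reals s2 4 l = wvec P c l by rewrite (F2.2 4 isT); apply: H1.
apply: (@hw_seq _ _ _ _ 40 (n * 85 + 60)); last by lia.
apply: hw_weak (hw_vcross (dst := 6) s2 (a := 4) (b := 5) _ _) _ _ => // s3 F3 H3 _.
have E3 := env_frame E2 F3 isT isT.
have N3 l : l < 3 -> reals s3 6 l = nvec P c l.
  by move=> l3; rewrite H3 // (crossv_ext H12 H2).
have W3 l : l < 3 -> reals s3 4 l = wvec P c l by rewrite (F3.2 4 isT); apply: H12.
apply: (@hw_seq _ _ _ _ 40 (n * 85 + 20)); last by lia.
apply: hw_weak (hw_vcross (dst := 7) s3 (a := 6) (b := 4) _ _) _ _ => // s4 F4 H4 _.
have E4 := env_frame E3 F4 isT isT.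
have X4 l : l < 3 -> reals s4 7 l = xvec P c l.
  by move=> l3; rewrite H4 // (crossv_ext N3 W3).
have N4 l : l < 3 -> reals s4 6 l = nvec P c l by rewrite (F4.2 6 isT); apply: N3.
have W4 l : l < 3 -> reals s4 4 l = wvec P c l by rewrite (F4.2 4 isT); apply: W3.
apply: (@hw_for _ _ _ _ (fun k s => forall i, i < k ->
    [/\ reals s 8 i = hN P c i, reals s 9 i = hX P c i & reals s 10 i = hY P c i]) n 69) => //.
- by move=> s' [FI _]; rewrite /= (FI 0 isT); case: E4.
- move=> k s' kn F' Ei HI.
  have [_ EP' _] := env_frame E4 F' isT isT.
  apply: hw_ev => // _ _ i; rewrite ltnS leq_eqVlt /= /update /= Ei.
  have kn3 : k < n + 3 by lia.
  case: eqP => [->|/eqP ik] /=; last by move/HI.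
  rewrite (F'.2 6 isT) (F'.2 7 isT) (F'.2 4 isT) !N4 // !X4 // !W4 // !EP' //.
- by move=> s' F' HI; split=> // l l3; rewrite (F'.2 6 isT) N4.
by rewrite /=; lia.
Qed.

Lemma ltn_S_inv i k : i < k.+1 -> i = k \/ i < k.
Proof. by rewrite ltnS leq_eqVlt => /orP[/eqP|]; auto. Qed.

Lemma same_sym c i j : same P rad c i j = same P rad c j i.
Proof. by rewrite /same eq_sym (eq_sym (rad i)). Qed.

Lemma same_trans c i j k : same P rad c i j -> same P rad c j k = same P rad c i k.
Proof. by rewrite /same => /andP[/eqP -> /eqP ->]. Qed.

Lemma hw_classes c s : env s -> heights c s ->
  halts_within Classes s (n * (n * 60 + 60) + 40) (fun s' => heights c s' /\ classes c s').
Proof.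
move=> Es Hs.
pose S := same P rad c.
apply: (@hw_seq _ _ _ _ 3 (n * (n * 60 + 60) + 30)); last by lia.
apply: hw_ev => // F0.
set s0 := ev _ s in F0 *.
have E0 := env_frame Es F0 isT isT.
have m0 : ints s0 6 0 = 0 by [].
have H0 : heights c s0 by [].
clearbody s0.
apply: (@hw_for _ _ _ _ (fun k s => [/\ ints s 6 0 = count (newb P rad c) (iota 0 k),
   forall i j, i < k -> j < k -> (ints s 7 i == ints s 7 j) = S i j &
   forall i, i < k -> ints s 7 i < ints s 6 0]) n (n * 60 + 40)) => //.
- by move=> s' [FI _]; rewrite /= (FI 0 isT); case: E0.
- move=> k s1 kn F1 Ei [I1 I2 I3].
  have E1 := env_frame E0 F1 isT isT.
  apply: (@hw_seq _ _ _ _ 5 (n * 60 + 35)); last by lia.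
  apply: hw_ev => // F2; set s2 := ev _ s1 in F2 *.
  have C2 : ints s2 7 k = ints s1 6 0 by rewrite /s2 /= /update /= Ei !eqxx.
  have C2' i : i < k -> ints s2 7 i = ints s1 7 i.
    by move=> ik; rewrite /s2 /= /update /= Ei (ltn_eqF ik).
  have E2 := env_frame E1 F2 isT isT.
  have m2 : ints s2 6 0 = ints s1 6 0 by rewrite (F2.1 6 isT).
  have k2 : ints s2 3 0 = k by rewrite (F2.1 3 isT).
  clearbody s2.
  apply: (@hw_seq _ _ _ _ (n * 60 + 10) 20); last by lia.
  (* Ball [k] has either adopted the class of an equivalent ball before [l], or met none and kept
     the fresh number. *)
  apply: (@hw_for _ _ _ _ (fun l s => (forall i, i < k -> ints s 7 i = ints s1 7 i) /\
     ((exists j, [/\ j < l, S k j & ints s 7 k = ints s1 7 j]) \/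
      (forall j, j < l -> ~~ S k j) /\ ints s 7 k = ints s1 6 0)) k 37) => //.
  + by move=> s' [FI _]; rewrite /= (FI 3 isT).
  + by split=> //; right.
  + move=> l s3 lk F3 El [J1 J2].
    have [_ _ rad3] := env_frame E2 F3 isT isT.
    have k3 : ints s3 3 0 = k by rewrite (F3.1 3 isT).
    have h3 i : i < n -> reals s3 8 i = hN P c i.
      by rewrite (F3.2 8 isT) (F2.2 8 isT) (F1.2 8 isT) => /(H0.2)[].
    have ST : beval s3 SameTest = S k l.
      have ln : l < n by lia.
      by rewrite /= k3 El !h3 // !rad3 // -!eq_le.
    apply: hw_ev => // _ _.
    have -> : ev (Ite SameTest (SetI 7 (V 3) (IGet 7 (V 4))) Skip) s3 =
      if S k l then State (update (ints s3) 7 k (ints s1 7 l)) (reals s3) else s3.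
      by rewrite -ST /= k3 El J1.
    case: ifP => Skl; rewrite /= /update /=.
      split; first by move=> i ik; rewrite (ltn_eqF ik) J1.
      by left; exists l; rewrite eqxx ltnSn.
    split=> //; case: J2 => [[j [jl Sj Ej]]|[NS Ek]].
      by left; exists j; split=> //; lia.
    right; split=> // j; rewrite ltnS leq_eqVlt => /orP[/eqP->|/NS //].
    by rewrite Skl.
  + move=> s3 F3 [J1 J2] _.
    have m3 : ints s3 6 0 = ints s1 6 0 by rewrite (F3.1 6 isT).
    have k3 : ints s3 3 0 = k by rewrite (F3.1 3 isT).
    apply: hw_ev => // _ _.
    have -> : ev (Ite (BLeI (V 6) (IGet 7 (V 3))) (SetI 6 (K 0) (IAdd (V 6) (K 1))) Skip) s3
      = if ints s1 6 0 <= ints s3 7 k then State (update (ints s3) 6 0 (ints s1 6 0 + 1)) (reals s3) else s3.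
      by rewrite /= m3 k3.
    have cnt : count (newb P rad c) (iota 0 k.+1) = ints s1 6 0 + newb P rad c k.
      by rewrite -addn1 iotaD count_cat I1 add0n /= addn0.
    rewrite cnt; case: J2 => [[j [jk Sj Ej]]|[NS Ek]].
      have -> : newb P rad c k = false.
        by apply/negbTE; rewrite negbK; apply/hasP; exists j; rewrite ?mem_iota.
      rewrite Ej leqNgt I3 //= addn0; split; rewrite /update /= ?m3 //.
        have aux i : i < k -> (ints s3 7 i == ints s3 7 k) = S i k.
          move=> ik; rewrite Ej J1 // I2 // /S [LHS]same_sym [RHS]same_sym.
          exact: same_trans Sj.
        move=> i i' /ltn_S_inv[->|ik] /ltn_S_inv[->|ik'].
        - by rewrite !eqxx /S /same !eqxx.
        - by rewrite eq_sym aux // /S same_sym.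
        - exact: aux.
        - by rewrite !J1 // I2.
      move=> i; rewrite ltnS leq_eqVlt => /orP[/eqP->|ik]; first by rewrite Ej I3.
      by rewrite J1 // I3.
    have -> : newb P rad c k.
      by apply/hasP => -[j]; rewrite mem_iota add0n => /= jk; apply/negP/NS.
    rewrite Ek leqnn; split; rewrite /= /update //=.
      have aux i : i < k -> (ints s3 7 i == ints s3 7 k) = S i k.
        move=> ik; rewrite Ek J1 // (ltn_eqF (I3 _ ik)) /S same_sym.
        by apply/esym/negbTE/NS.
      move=> i i' /ltn_S_inv[->|ik] /ltn_S_inv[->|ik'].
      - by rewrite !eqxx /S /same !eqxx.
      - by rewrite eq_sym aux // /S same_sym.
      - exact: aux.
      - by rewrite !J1 // I2.
    move=> i; rewrite ltnS leq_eqVlt => /orP[/eqP->|ik]; first by rewrite Ek addn1.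
    by rewrite J1 // ltn_addr // I3.
  by rewrite /=; nia.
- move=> s1 F1 [I1 I2 I3]; split.
    split=> [l l3|i /(H0.2)[]]; first by rewrite (F1.2 6 isT) H0.1.
    by rewrite (F1.2 8 isT) (F1.2 9 isT) (F1.2 10 isT).
  by split; rewrite /ncl -?I1.
by rewrite /=; nia.
Qed.

Lemma hw_evaln c s : env s ->
  (forall j, j < 4 -> ints s 21 j = c j /\ c j < n + 3) ->
  halts_within EvalN s (n * n * 500) (fun s' => heights c s' /\ classes c s').
Proof.
move=> Es Hc.
apply: (@hw_seq _ _ _ _ (n * 85 + 180) (n * (n * 60 + 60) + 40)); last by nia.
apply: hw_weak (hw_heights Es Hc) _ _ => // s1 F1 H1 _.
exact: (hw_classes (env_frame Es F1 isT isT) H1).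
Qed.

End EvalNSpec.

(** * Searching for the best candidate *)

(** Horner's scheme; it guarantees that the odometer reaches any desired digit sequence. *)
Lemma dig_surj b m (g : nat -> nat) : 0 < b -> (forall j, j < m -> g j < b) ->
  exists2 t, t < b ^ m & forall j, j < m -> dig b t j = g j.
Proof.
move=> b0; elim: m g => [|m IH] g Hg; first by exists 0.
have [j jm|t tm Ht] := IH (fun j => g j.+1); first exact: (Hg j.+1).
have g0 := Hg 0 isT.
exists (t * b + g 0).
  by rewrite expnSr; apply: (@leq_trans (t.+1 * b)); [rewrite mulSn; lia|rewrite leq_mul2r tm orbT].
case=> [|j] jm; first by rewrite /dig expn0 divn1 modnMDl modn_small.
by rewrite /dig expnS divnMA divnMDl // (divn_small g0) addn0 -[RHS]Ht.
Qed.

(* Array 2 holds n + 3, the number of points with the three virtual ones; array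
   13 the least number of classes found so far and array 14 its candidate. *)
Definition Virtual : com :=
  let f l t := SetR l (IAdd (V 0) (K t))
     (RAdd (RGet l (K 0)) (RConst (nat_of_bool (l == t)))) in
  Seq (f 0 0) (Seq (f 0 1) (Seq (f 0 2) (Seq (f 1 0) (Seq (f 1 1) (Seq (f 1 2)
  (Seq (f 2 0) (Seq (f 2 1) (f 2 2)))))))).

Definition Copy4 (dst src : nat) : com :=
  let f l := SetI dst (K l) (IGet src (K l)) in
  Seq (f 0) (Seq (f 1) (Seq (f 2) (f 3))).

Definition BetterTest : bexp :=
  let f l := RMul (RGet 6 (K l)) (RGet 6 (K l)) in
  BAnd (BNot (BLeR (RAdd (RAdd (f 0) (f 1)) (f 2)) (RConst 0))) (BNot (BLeI (V 13) (V 6))).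

Definition TryCand : com :=
  Seq EvalN (Ite BetterTest (Seq (SetI 13 (K 0) (V 6)) (Copy4 14 21)) Skip).

(** Both frame vectors start at the first center, so two digits determine the candidate. *)
Definition SetCandA : com :=
  Seq (SetI 21 (K 0) (K 0)) (Seq (SetI 21 (K 1) (IGet 8 (K 0)))
  (Seq (SetI 21 (K 2) (K 0)) (SetI 21 (K 3) (IGet 8 (K 1))))).

Definition SearchA : com :=
  Seq (SetI 11 (K 0) (K 2)) (Odo 8 11 2 9 10 (Seq SetCandA TryCand)).
Definition SearchB : com :=
  Seq (SetI 11 (K 0) (K 4)) (Odo 8 11 2 9 10 (Seq (Copy4 21 8) TryCand)).

(** The initial record [n + 1] exceeds every possible number of classes. The search over four free
    indices is entered only if the cheap one has not reached a single class, which protects the time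
    bound when one class is enough. *)
Definition Search : com :=
  Seq (Seq (SetI 13 (K 0) (IAdd (V 0) (K 1))) (SetI 2 (K 0) (IAdd (V 0) (K 3))))
  (Seq SearchA (Ite (BLeI (K 2) (V 13)) SearchB Skip)).

Section SearchSpec.
Variables (R : realType) (n : nat) (P : nat -> nat -> R) (rad : nat -> R).
Implicit Types s : state R.
Hypothesis n0 : 0 < n.

Definition valid (c : nat -> nat) := (0 < dotv (nvec P c) (nvec P c))%R.
Definition saved s : Prop :=
  ints s 13 0 = n.+1 \/ exists c : nat -> nat,
    [/\ forall j, j < 4 -> ints s 14 j = c j /\ c j < n + 3, valid c &
        ints s 13 0 = ncl P n rad c].

Lemma saved_eq s s' : saved s -> ints s' 13 = ints s 13 -> ints s' 14 = ints s 14 -> saved s'.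
Proof. by move=> Ss E1 E2; rewrite /saved E1 E2. Qed.

Lemma hw_trycand c s : env n P rad s -> saved s ->
  (forall j, j < 4 -> ints s 21 j = c j /\ c j < n + 3) ->
  halts_within TryCand s (n * n * 560) (fun s' => [/\ saved s', ints s' 13 0 <= ints s 13 0 &
     valid c -> ints s' 13 0 <= ncl P n rad c]).
Proof.
move=> Es Ss Hc.
apply: (@hw_seq _ _ _ _ (n * n * 500) 60); last by nia.
apply: hw_weak (hw_evaln n0 Es Hc) _ _ => // s1 F1 [[HN _] [Hm _ _]] _.
have T1 : beval s1 BetterTest = valid c && (ncl P n rad c < ints s 13 0).
  by rewrite /= !HN // Hm (F1.1 13 isT) -ltNge -ltnNge.
have Hc1 j : j < 4 -> ints s1 21 j = c j /\ c j < n + 3 by rewrite (F1.1 21 isT); apply: Hc.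
have S1 := saved_eq Ss (F1.1 13 isT) (F1.1 14 isT).
apply: hw_ev => //.
rewrite [ev _ _](_ : _ = if beval s1 BetterTest then
   ev (Seq (SetI 13 (K 0) (V 6)) (Copy4 14 21)) s1 else s1) // T1.
case: ifP => [/andP[Hv lt]|H].
  have E13 : ints (ev (Seq (SetI 13 (K 0) (V 6)) (Copy4 14 21)) s1) 13 0 = ncl P n rad c by [].
  rewrite E13; split=> //; last exact: ltnW.
  right; exists c; split=> // j j4; have [Ej cj] := Hc1 j j4; split=> //.
  by case: j j4 Ej {cj} => [|[|[|[|]]]].
split=> //; first by rewrite (F1.1 13 isT).
by move=> Hv; move: H; rewrite Hv (F1.1 13 isT) /= => /negbT; rewrite -leqNgt.
Qed.

Lemma hw_search_odo D (set : com) (cd : nat -> nat -> nat) s :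
  0 < D -> loopfree set -> wcost set <= 40 ->
  (forall s, ints s 11 0 = D -> forall t, (forall j, j < D -> ints s 8 j = dig (n + 3) t j) ->
     forall j, j < 4 -> ints (ev set s) 21 j = cd t j /\ cd t j < n + 3) ->
  all (fun a => nowI a set) [:: 0; 2; 3; 8; 11; 13; 14] -> (forall a, nowR a set) ->
  env n P rad s -> saved s -> ints s 2 0 = n + 3 ->
  halts_within (Seq (SetI 11 (K 0) (K D)) (Odo 8 11 2 9 10 (Seq set TryCand))) s
    ((n + 3) ^ D * (n * n * 650 + D * 40) + D * 20 + 30)
    (fun s' => [/\ saved s', ints s' 13 0 <= ints s 13 0 &
       forall t, t < (n + 3) ^ D -> valid (cd t) -> ints s' 13 0 <= ncl P n rad (cd t)]).
Proof.
move=> D0 lf wc Hset /= /and5P[N0 N2 N3 N8 /and4P[N11 N13 N14 _]] NR Es Ss E2.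
apply: (@hw_seq _ _ _ _ 3 ((n + 3) ^ D * (n * n * 650 + D * 40) + D * 20 + 20)); last by lia.
apply: hw_ev => // F1; set s1 := ev _ s in F1 *.
have Es1 : env n P rad s1 by apply: env_eq Es _ _.
have Ss1 : saved s1 by [].
have E21 : ints s1 2 0 = n + 3 by [].
have E11 : ints s1 11 0 = D by [].
have E13 : ints s1 13 0 = ints s 13 0 by [].
rewrite -E13; clearbody s1; clear F1 Es Ss E2 E13.
apply: (@hw_odo _ 8 11 2 9 10 D (n + 3) _ (fun t s => [/\ saved s, ints s 13 0 <= ints s1 13 0 &
   forall t', t' < t -> valid (cd t') -> ints s 13 0 <= ncl P n rad (cd t')]) (n * n * 560 + 40)) => //.
- by rewrite addn_gt0 n0.
- by rewrite /= N8 N11 N2.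
- move=> t s2 s3 [I1 I2 I3] Hi _; split; rewrite ?(Hi 13) //.
  by apply: saved_eq I1 _ _; apply: Hi.
- move=> t s2 tb F2 Hd [I1 I2 I3].
  have Es2 : env n P rad s2.
    apply: env_eq Es1 _ _; first by apply: F2.1; rewrite /= N0.
    by move=> l l4; apply: F2.2 => /=; rewrite NR /=; case: l l4 => [|[|[|[|]]]].
  have D2 : ints s2 11 0 = D by rewrite F2.1 //= N11.
  apply: (@hw_seq _ _ _ _ 40 (n * n * 560)); last by lia.
  apply: hw_ev => // F3; have Hc := Hset _ D2 _ Hd.
  set s3 := ev set s2 in F3 Hc *.
  have Es3 : env n P rad s3.
    by apply: (env_frame Es2 F3) => //=; rewrite !NR.
  have Ss3 : saved s3 by apply: saved_eq I1 (F3.1 _ N13) (F3.1 _ N14).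
  apply: hw_weak (hw_trycand Es3 Ss3 Hc) _ _ => // s4 _ [J1 J2 J3] _.
  rewrite (F3.1 13 N13) in J2; split=> //; first exact: leq_trans I2.
  move=> t' /ltn_S_inv[->|tt'] // Hv; apply: leq_trans J2 _; exact: I3.
rewrite leq_add2r leq_add2r; apply: leq_mul => //; rewrite addnAC; nia.
Qed.

(** The flag [small] promises that a cheap candidate attains one class, so no time is budgeted for
    the second phase. A record above 1 at the end shows that the second phase was run, and then all
    candidates have been compared. *)
Lemma hw_search (small : bool) s : env n P rad s ->
  (small -> exists c, [/\ forall j, j < 4 -> c j < n + 3, c 0 = 0 /\ c 2 = 0, valid c & ncl P n rad c <= 1]) ->
  halts_within Search s
    ((n + 3) ^ 2 * (n * n * 650 + 80) + (if small then 0 else (n + 3) ^ 4 * (n * n * 650 + 160)) + 250)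
    (fun s' => saved s' /\
      forall c, (forall j, j < 4 -> c j < n + 3) -> valid c ->
        (c 0 = 0 /\ c 2 = 0) \/ ints s' 13 0 > 1 -> ints s' 13 0 <= ncl P n rad c).
Proof.
move=> Es Hsmall.
set T4 := if small then _ else _.
apply: (@hw_seq _ _ _ _ 12 ((n + 3) ^ 2 * (n * n * 650 + 80) + T4 + 238)); last by lia.
apply: hw_ev => // F1; set s1 := ev _ s in F1 *.
have [E0 _ _] := Es.
have Es1 := env_frame Es F1 isT isT.
have E2 : ints s1 2 0 = n + 3 by rewrite /s1 /= /update /= E0.
have Ss1 : saved s1 by left; rewrite /s1 /= /update /= E0 addn1.
clearbody s1.
apply: (@hw_seq _ _ _ _ ((n + 3) ^ 2 * (n * n * 650 + 80) + 70) (T4 + 168)); last by lia.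
pose cdA t := cand4 0 (dig (n + 3) t 0) 0 (dig (n + 3) t 1).
have n3 : 0 < n + 3 by rewrite addn_gt0 n0.
have HA := @hw_search_odo 2 SetCandA cdA s1 isT isT isT _ isT (fun=> isT) Es1 Ss1 E2.
apply: hw_weak (HA _) _ _.
- by move=> s' _ t Hd [|[|[|[|]]]] // _; rewrite /cdA /cand4 /= /update /= ?Hd // ?dig_lt //; split.
- by rewrite (mulnC 2 40); lia.
move=> s2 F2 [S2 _ B2] _; clear HA.
have Es2 := env_frame Es1 F2 isT isT.
have E22 : ints s2 2 0 = n + 3 by rewrite (F2.1 2 isT).
have BA c : (forall j, j < 4 -> c j < n + 3) -> valid c -> c 0 = 0 /\ c 2 = 0 ->
    ints s2 13 0 <= ncl P n rad c.
  move=> Hc Hv [c0 c2].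
  have [|t tb Ht] := @dig_surj (n + 3) 2 (fun j => nth 0 [:: c 1; c 3] j) n3.
    by case=> [|[|]] // _; apply: Hc.
  have Ec : [/\ cdA t 0 = c 0, cdA t 1 = c 1, cdA t 2 = c 2 & cdA t 3 = c 3].
    by rewrite /cdA /cand4 /= !Ht // c0 c2.
  have := B2 t tb; rewrite /valid /ncl /newb /same /hN /nvec /wvec /vvec.
  by case: Ec => -> -> -> ->; apply.
apply: (@hw_ite _ _ _ _ _ (T4 + 160)); last by rewrite /=; lia.
  (* Under [small] this branch is impossible: the first phase has already recorded at most one
     class. *)
  rewrite /= => b2; rewrite {}/T4; case: small Hsmall => Hsmall.
    have [c [c1 c2 c3 c4]] := Hsmall isT.
    by have := leq_trans b2 (leq_trans (BA c c1 c3 c2) c4).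
  pose cdB t := cand4 (dig (n + 3) t 0) (dig (n + 3) t 1) (dig (n + 3) t 2) (dig (n + 3) t 3).
  have HB := @hw_search_odo 4 (Copy4 21 8) cdB s2 isT isT isT _ isT (fun=> isT) Es2 S2 E22.
  apply: hw_weak (HB _) _ _.
  - by move=> s' _ t Hd [|[|[|[|]]]] // _; rewrite /cdB /cand4 /= /update /= ?Hd // ?dig_lt //.
  - by rewrite (mulnC 4 40); lia.
  move=> s3 F3 [S3 _ B3]; split=> // c Hc Hv _.
  have [|t tb Ht] := @dig_surj (n + 3) 4 c n3; first exact: Hc.
  have Ec : [/\ cdB t 0 = c 0, cdB t 1 = c 1, cdB t 2 = c 2 & cdB t 3 = c 3].
    by rewrite /cdB /cand4 /= !Ht.
  have := B3 t tb; rewrite /valid /ncl /newb /same /hN /nvec /wvec /vvec.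
  by case: Ec => -> -> -> ->; apply.
rewrite /= -ltnNge => b2; apply: hw_ev => //; first by rewrite (leq_trans _ (leq_addl _ _)).
split=> // c Hc Hv [H|H]; first exact: BA.
by rewrite ltnNge -ltnS b2 in H.
Qed.

Lemma hw_virtual s : (forall l, l < 3 -> forall x, x < n -> reals s l x = P l x) -> ints s 0 0 = n ->
  (forall x, x < n -> reals s 3 x = rad x) -> virtual_points P n ->
  halts_within Virtual s 100 (env n P rad).
Proof.
move=> HP E0 Hr HV; apply: hw_ev => //; split=> [//|l x l3 xn|x xn]; last exact: Hr.
(* Writing the virtual points never overwrites point 0, from which they are computed. *)
have N0 t : (0 == n + t) = false by apply/eqP; lia.
rewrite /= /update /= E0.
have [xn'|xn'] := ltnP x n.
  have D t : (x == n + t) = false by apply/eqP; lia.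
  by rewrite !D !andbF HP.
have [t -> t3] : exists2 t, x = n + t & t < 3 by exists (x - n); lia.
rewrite HV // !eqn_add2l.
by case: l l3 => [|[|[|]]] // _; case: t t3 {xn xn'} => [|[|[|]]] // _; rewrite /= ?N0 HP.
Qed.

End SearchSpec.

(** * Evaluating a guess *)

(* Array 8 holds the guess: positions c and m + c contain the extreme balls of
   class c.  Array 16 marks deleted balls; 15 receives the side (1 or 2) of each
   remaining ball, 0 standing for inconsistent ones. *)
Definition GLeft (e : iexp) := IGet 8 (IGet 7 e).
Definition GRight (e : iexp) := IGet 8 (IAdd (V 6) (IGet 7 e)).

(** Both guessed balls for the class of [e] must belong to that class; otherwise the class counts as
    absent from the clique. *)
Definition ValidTest (e : iexp) : bexp :=
  BAnd (BEqI (IGet 7 (GLeft e)) (IGet 7 e)) (BEqI (IGet 7 (GRight e)) (IGet 7 e)).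

Definition NearTest (a b : iexp) : bexp :=
  let f l := RMul (RSub (RGet l a) (RGet l b)) (RSub (RGet l a) (RGet l b)) in
  BLeR (RAdd (RAdd (f 0) (f 1)) (f 2))
    (RMul (RAdd (RGet 3 a) (RGet 3 b)) (RAdd (RGet 3 a) (RGet 3 b))).

Definition BetweenTest : bexp :=
  BAnd (BLeI (IGet 16 (V 3)) (K 0)) (BAnd (ValidTest (V 3))
   (BAnd (BLeR (RGet 9 (GLeft (V 3))) (RGet 9 (V 3))) (BLeR (RGet 9 (V 3)) (RGet 9 (GRight (V 3)))))).

Definition UpperTest : bexp :=
  let x e := RGet 9 e in let y e := RGet 10 e in
  let v := V 3 in let l := GLeft v in let r := GRight v in
  BAnd (BLeR (RMul (RSub (x v) (x l)) (RSub (y r) (y l))) (RMul (RSub (x r) (x l)) (RSub (y v) (y l))))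
    (BOr (BNot (BLeR (x r) (x l))) (BLeR (y l) (y v))).

Definition FarTest : bexp :=
  BAnd (ValidTest (V 4)) (BNot (BAnd (NearTest (V 3) (GLeft (V 4))) (NearTest (V 3) (GRight (V 4))))).

Definition Sides : com :=
  For 3 (V 0) (Seq (SetI 15 (V 3) (K 0))
    (Ite BetweenTest
      (Seq (Ite UpperTest (SetI 15 (V 3) (K 1)) (SetI 15 (V 3) (K 2)))
        (For 4 (V 0) (Ite FarTest (SetI 15 (V 3) (K 0)) Skip)))
      Skip)).

(** Sides are 0, 1 or 2, so the sum 3 singles out pairs with one ball on each side. *)
Definition ConflictTest : bexp :=
  BAnd (BEqI (IAdd (IGet 15 (V 3)) (IGet 15 (V 4))) (K 3)) (BNot (NearTest (V 3) (V 4))).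

(** Writes the matrix of the conflict graph row by row; the running index in array 5 replaces
    [i * n + j], as integers cannot be multiplied. *)
Definition Build : com :=
  Seq (Seq (SetI 5 (K 0) (K 0)) (SetI 32 (K 0) (V 0)))
  (For 3 (V 0) (For 4 (V 0)
    (Seq (Ite ConflictTest (SetI 33 (V 5) (K 1)) (SetI 33 (V 5) (K 0)))
         (SetI 5 (K 0) (IAdd (V 5) (K 1)))))).

(** Counts all of side 2 and the unmatched balls of side 1, which by Koenig's theorem is the size of
    a largest independent set of the conflict graph. *)
Definition UncoveredTest : bexp :=
  BOr (BEqI (IGet 15 (V 3)) (K 2))
      (BAnd (BEqI (IGet 15 (V 3)) (K 1))
            (BNot (BAnd (BLeI (K 1) (IGet 34 (V 3))) (BLeI (IGet 34 (V 3)) (V 0))))).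

Definition Count : com :=
  Seq (SetI 17 (K 0) (K 0))
  (For 3 (V 0) (Ite UncoveredTest (SetI 17 (K 0) (IAdd (V 17) (K 1))) Skip)).

Definition EvalG (matching : com) : com :=
  Seq Sides (Seq Build (Seq (shift matching) Count)).

Arguments EvalG : simpl never.

Lemma nowI_evalg a matching : a < 32 -> a \notin [:: 3; 4; 5; 15; 17] -> nowI a (EvalG matching).
Proof.
move=> a32; rewrite !inE !negb_or /EvalG /= nowI_shift // => /and5P[-> -> -> -> ->].
by have [-> ->] : (a != 32) /\ (a != 33) by lia.
Qed.

Lemma nowR_evalg a matching : a < 32 -> nowR a (EvalG matching).
Proof. by move=> a32; rewrite /EvalG /= nowR_shift. Qed.

Section Guess.
Variables (R : realType) (n : nat) (P : nat -> nat -> R) (rad : nat -> R).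
Variables (c cl : nat -> nat) (m : nat).
Implicit Types (s : state R) (d : nat -> nat).
Hypothesis n0 : 0 < n.
Hypothesis cl_lt : forall i, i < n -> cl i < m.

Definition near i j : bool := (sqd (pt P i) (pt P j) <= (rad i + rad j) ^+ 2)%R.
Definition validb d x := (cl (d (cl x)) == cl x) && (cl (d (m + cl x)) == cl x).
Definition okb d v := [&& validb d v, (hX P c (d (cl v)) <= hX P c v)%R,
  (hX P c v <= hX P c (d (m + cl v)))%R &
  all (fun x => validb d x ==> near v (d (cl x)) && near v (d (m + cl x))) (iota 0 n)].
Definition upb d v := upper (hX P c (d (cl v))) (hX P c (d (m + cl v))) (hX P c v)
  (hY P c (d (cl v))) (hY P c (d (m + cl v))) (hY P c v).
Definition sideb d (al : nat -> bool) v : nat :=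
  if al v && okb d v then (if upb d v then 1 else 2) else 0.
Definition conflict (sd : nat -> nat) i j := (sd i + sd j == 3) && ~~ near i j.

Definition genv d s : Prop :=
  [/\ env n P rad s, forall i, i < n -> reals s 9 i = hX P c i /\ reals s 10 i = hY P c i,
      ints s 6 0 = m, forall i, i < n -> ints s 7 i = cl i &
      forall j, j < m + m -> ints s 8 j = d j /\ d j < n].

Lemma genv_eq d s s' : genv d s -> (forall a, a \in [:: 0; 6; 7; 8] -> ints s' a = ints s a) ->
  (forall a, a < 11 -> reals s' a = reals s a) -> genv d s'.
Proof.
move=> [G1 G2 G3 G4 G5] HI HR; split; rewrite ?HI ?HR //.
by apply: env_eq G1 _ _; [apply: HI|move=> l l4; apply: HR; apply: ltn_trans l4 _].
Qed.

Lemma genv_frame d C s s' : genv d s -> frame C s s' -> all (fun a => nowI a C) [:: 0; 6; 7; 8] ->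
  (forall a, a < 11 -> nowR a C) -> genv d s'.
Proof.
move=> G [FI FR] NI NR; apply: (genv_eq G) => a Ha; first by apply: FI; apply: (allP NI).
by apply: FR; apply: NR.
Qed.

Section Tests.
Variables (d : nat -> nat) (s : state R).
Hypothesis G : genv d s.

Lemma ieval_gleft e x : ieval s e = x -> x < n ->
  ieval s (GLeft e) = d (cl x) /\ d (cl x) < n.
Proof.
move=> Ee xn; case: G => _ _ _ G4 G5; rewrite /= Ee G4 //.
by apply: G5; apply: leq_trans (cl_lt xn) (leq_addr _ _).
Qed.

Lemma ieval_gright e x : ieval s e = x -> x < n ->
  ieval s (GRight e) = d (m + cl x) /\ d (m + cl x) < n.
Proof.
move=> Ee xn; case: G => _ _ G3 G4 G5; rewrite /= Ee G3 G4 //.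
by apply: G5; rewrite ltn_add2l cl_lt.
Qed.

Lemma beval_and b1 b2 : beval s (BAnd b1 b2) = beval s b1 && beval s b2.
Proof. by []. Qed.

Lemma beval_not b : beval s (BNot b) = ~~ beval s b.
Proof. by []. Qed.

Lemma beval_leI e1 e2 : beval s (BLeI e1 e2) = (ieval s e1 <= ieval s e2).
Proof. by []. Qed.

Lemma beval_leR e1 e2 : beval s (BLeR e1 e2) = (reval s e1 <= reval s e2)%R.
Proof. by []. Qed.

Lemma reval_get a e : reval s (RGet a e) = reals s a (ieval s e).
Proof. by []. Qed.

Lemma reval_sub e1 e2 : reval s (RSub e1 e2) = (reval s e1 - reval s e2)%R.
Proof. by []. Qed.

Lemma reval_mul e1 e2 : reval s (RMul e1 e2) = (reval s e1 * reval s e2)%R.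
Proof. by []. Qed.

Lemma ieval_get a e : ieval s (IGet a e) = ints s a (ieval s e).
Proof. by []. Qed.

Lemma ieval_const k : ieval s (K k) = k.
Proof. by []. Qed.

Lemma beval_eqI e1 e2 : beval s (BEqI e1 e2) = (ieval s e1 == ieval s e2).
Proof. by rewrite /= -eqn_leq. Qed.

Lemma beval_or b1 b2 : beval s (BOr b1 b2) = beval s b1 || beval s b2.
Proof. by rewrite /= negb_and !negbK. Qed.

Lemma beval_valid e x : ieval s e = x -> x < n -> beval s (ValidTest e) = validb d x.
Proof.
move=> Ee xn; have [EL Lx] := ieval_gleft Ee xn; have [ER Rx] := ieval_gright Ee xn.
case: G => _ _ _ G4 _.
have C e' y : ieval s e' = y -> y < n -> ieval s (IGet 7 e') = cl y by move=> /= -> /G4.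
rewrite /ValidTest beval_and !beval_eqI.
by rewrite (C _ _ EL Lx) (C _ _ ER Rx) (C _ _ Ee xn).
Qed.

Lemma beval_near e1 e2 x y : ieval s e1 = x -> x < n -> ieval s e2 = y -> y < n ->
  beval s (NearTest e1 e2) = near x y.
Proof.
move=> E1 xn E2 yn; case: G => [[_ EP Er] _ _ _ _].
have [x3 y3] : x < n + 3 /\ y < n + 3 by lia.
by rewrite /NearTest /= E1 E2 !(EP 0) // !(EP 1) // !(EP 2) // !Er // /near /sqd /dotv /subv /pt.
Qed.

Lemma beval_between (al : nat -> bool) x : ints s 3 0 = x -> x < n -> (ints s 16 x == 0) = al x ->
  beval s BetweenTest =
    [&& al x, validb d x, (hX P c (d (cl x)) <= hX P c x)%R & (hX P c x <= hX P c (d (m + cl x)))%R].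
Proof.
move=> Ex xn Ha; have Ee : ieval s (V 3) = x by [].
have [EL Lx] := ieval_gleft Ee xn; have [ER Rx] := ieval_gright Ee xn.
rewrite /BetweenTest beval_and beval_and (beval_valid Ee xn) beval_and beval_leI !beval_leR !reval_get EL ER.
rewrite ieval_get Ee ieval_const leqn0 Ha.
by case: G => _ G2 _ _ _; have [-> _] := G2 _ Lx; have [-> _] := G2 _ Rx; have [-> _] := G2 _ xn.
Qed.

Lemma beval_upper x : ints s 3 0 = x -> x < n -> beval s UpperTest = upb d x.
Proof.
move=> Ex xn; have Ee : ieval s (V 3) = x by [].
have [EL Lx] := ieval_gleft Ee xn; have [ER Rx] := ieval_gright Ee xn.
case: G => _ G2 _ _ _.
have C e y : ieval s e = y -> y < n -> reval s (RGet 9 e) = hX P c y /\ reval s (RGet 10 e) = hY P c y.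
  by move=> /= -> /G2.
have [XL YL] := C _ _ EL Lx; have [XR YR] := C _ _ ER Rx; have [XV YV] := C _ _ Ee xn.
rewrite /UpperTest beval_and beval_or beval_not !beval_leR !reval_mul !reval_sub.
by rewrite XL XR XV YL YR YV -ltNge.
Qed.

Lemma beval_far v x : ints s 3 0 = v -> v < n -> ints s 4 0 = x -> x < n ->
  beval s FarTest = ~~ (validb d x ==> near v (d (cl x)) && near v (d (m + cl x))).
Proof.
move=> Ev vn Ex xn; have Ee : ieval s (V 4) = x by []; have Ee' : ieval s (V 3) = v by [].
have [EL Lx] := ieval_gleft Ee xn; have [ER Rx] := ieval_gright Ee xn.
rewrite /FarTest beval_and (beval_valid Ee xn) beval_not beval_and.
rewrite (beval_near Ee' vn EL Lx) (beval_near Ee' vn ER Rx).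
by rewrite negb_imply.
Qed.

End Tests.

Lemma hw_sides d (al : nat -> bool) s : genv d s ->
  (forall i, i < n -> (ints s 16 i == 0) = al i) ->
  halts_within Sides s (n * (n * 340 + 340) + 40)
    (fun s' => forall i, i < n -> ints s' 15 i = sideb d al i).
Proof.
move=> Gs Ha.
apply: (@hw_for _ _ _ _ (fun k s => forall i, i < k -> ints s 15 i = sideb d al i) n (n * 340 + 310)) => //.
- by move=> s' [FI _]; rewrite /= (FI 0 isT); case: Gs => [[]].
- move=> k s1 kn F1 Ek I1.
  have G1 : genv d s1 by apply: genv_frame Gs F1 isT _.
  have A1 : (ints s1 16 k == 0) = al k by rewrite (F1.1 16 isT) Ha.
  apply: (@hw_seq _ _ _ _ 4 (n * 340 + 306)); last by lia.
  apply: hw_ev => // F2; set s2 := ev _ s1 in F2 *.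
  have G2 : genv d s2 by apply: genv_frame G1 F2 isT _.
  have k2 : ints s2 3 0 = k by [].
  have A2 : (ints s2 16 k == 0) = al k by [].
  have S2 i : ints s2 15 i = if i == k then 0 else ints s1 15 i by rewrite /s2 /= /update /= Ek.
  clearbody s2.
  apply: (@hw_ite _ _ _ _ _ (n * 340 + 200)); last by rewrite /=; lia.
    rewrite (beval_between G2 k2 kn A2) => B.
    apply: (@hw_seq _ _ _ _ 170 (n * 340 + 30)); last by lia.
    apply: hw_ev => //.
    rewrite [ev _ _](_ : _ = State (update (ints s2) 15 k (if upb d k then 1 else 2)) (reals s2)); last first.
      by rewrite -(beval_upper G2 k2 kn) /= k2; case: ifP.
    set s3 := State _ _ => F3.
    have G3 : genv d s3 by apply: genv_frame G2 F3 isT _.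
    have k3 : ints s3 3 0 = k by [].
    have S3 i : ints s3 15 i = if i == k then (if upb d k then 1 else 2) else ints s1 15 i.
      by rewrite /s3 /= /update /=; case: eqP => //; rewrite S2 => /eqP/negbTE->.
    clearbody s3.
    pose fine x := validb d x ==> near k (d (cl x)) && near k (d (m + cl x)).
    apply: (@hw_for _ _ _ _ (fun l s => forall i, ints s 15 i = if i == k then
       (if all fine (iota 0 l) then (if upb d k then 1 else 2) else 0) else ints s1 15 i) n 320) => //.
    + by move=> s' [FI _]; rewrite /= (FI 0 isT); case: G3 => [[]].
    + move=> l s4 ln F4 El I4.
      have G4 : genv d s4 by apply: genv_frame G3 F4 isT _.
      have k4 : ints s4 3 0 = k by rewrite (F4.1 3 isT).
      apply: hw_ev => // _ _ i.
      rewrite [ev _ _](_ : _ = if ~~ fine l then State (update (ints s4) 15 k 0) (reals s4) else s4); last first.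
        by rewrite -(beval_far G4 k4 kn El ln) /= k4.
      have -> : all fine (iota 0 l.+1) = all fine (iota 0 l) && fine l.
        by rewrite -addn1 iotaD all_cat add0n /= andbT.
      case: (fine l) => /=; first by rewrite andbT /= /update /= I4.
      by rewrite andbF /update /=; case: eqP => // /eqP/negbTE ik; rewrite I4 ik.
    + move=> s4 _ I4 _ _ i ik1; rewrite /= /update /= I4.
      case: eqP => [->|/eqP ik]; last by apply: I1; move: ik1; rewrite ltnS leq_eqVlt (negbTE ik).
      rewrite /sideb /okb; move: B => /and4P[-> -> -> ->] /=.
      by [].
    by rewrite /=; lia.
  rewrite (beval_between G2 k2 kn A2) => B.
  apply: hw_ev => //; first by rewrite /=; lia.
  move=> _ _ i ik1; rewrite /= /update /= S2.
  case: eqP => [->|/eqP ik]; last by apply: I1; move: ik1; rewrite ltnS leq_eqVlt (negbTE ik).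
  rewrite /sideb /okb; move: B; case: (al k) => //=; case: (validb d k) => //=.
  by case: (_ <= _)%R => //=; case: (_ <= _)%R.
by rewrite /=; lia.
Qed.

Lemma hw_build d (sd : nat -> nat) s : genv d s ->
  (forall i, i < n -> ints s 15 i = sd i) ->
  halts_within Build s (n * (n * 140 + 40) + 40)
    (fun s' => ints s' 32 0 = n /\
       forall i j, i < n -> j < n -> ints s' 33 (i * n + j) = conflict sd i j).
Proof.
move=> Gs Hs.
have E0 : ints s 0 0 = n by case: Gs => [[]].
apply: (@hw_seq _ _ _ _ 12 (n * (n * 140 + 40) + 28)); last by lia.
apply: hw_ev => // F1; set s1 := ev _ s in F1 *.
have G1 : genv d s1 by apply: genv_frame Gs F1 isT _.
have S1 i : i < n -> ints s1 15 i = sd i by rewrite (F1.1 15 isT); apply: Hs.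
have I1 : ints s1 5 0 = 0 by [].
have N1 : ints s1 32 0 = n by [].
clearbody s1.
pose J (z : nat) s := ints s 5 0 = z /\ forall i j, j < n -> i * n + j < z -> ints s 33 (i * n + j) = conflict sd i j.
apply: (@hw_for _ _ _ _ (fun k => J (k * n)) n (n * 140 + 20)) => //.
- by move=> s' [FI _]; rewrite /= (FI 0 isT); case: G1 => [[]].
- move=> k s2 kn F2 Ek J2.
  have G2 : genv d s2 by apply: genv_frame G1 F2 isT _.
  apply: (@hw_for _ _ _ _ (fun l => J (k * n + l)) n 118) => //.
  + by move=> s' [FI _]; rewrite /= (FI 0 isT); case: G2 => [[]].
  + by rewrite addn0; exact: J2.
  + move=> l s3 ln F3 El [J3 J3'].
    have G3 : genv d s3 by apply: genv_frame G2 F3 isT _.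
    have k3 : ints s3 3 0 = k by rewrite (F3.1 3 isT).
    have S3 i : i < n -> ints s3 15 i = sd i by rewrite (F3.1 15 isT) (F2.1 15 isT); apply: S1.
    have T3 : beval s3 ConflictTest = conflict sd k l.
      rewrite /ConflictTest beval_and beval_eqI beval_not.
      rewrite (beval_near G3 (x := k) (y := l)) //.
      by rewrite /= k3 El !S3.
    apply: hw_ev => // _ _.
    rewrite [ev _ _](_ : _ = State (update (update (ints s3) 33 (k * n + l) (conflict sd k l)) 5 0 (k * n + l).+1) (reals s3)).
      split; first by rewrite /= /update /= addnS.
      move=> i j jn; rewrite /= /update /= addnS ltnS leq_eqVlt; case: eqP => [E|_ /=]; last exact: J3'.
      (* Euclidean division by [n] recovers row and column from the index. *)
      have nz := n0; have [-> ->] // : i = k /\ j = l.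
      have : (i * n + j) %/ n = (k * n + l) %/ n by rewrite E.
      rewrite !divnMDl // !divn_small // !addn0 => ik; split=> //.
      by move: E; rewrite ik => /addnI.
    rewrite /= -[_ && _]/(beval s3 ConflictTest) T3 J3.
    by case: conflict; rewrite /= /update /= ?J3 addn1.
  + by move=> s3 F3 J3 _ _; rewrite /= mulSn addnC.
  by rewrite /=; lia.
- move=> s2 F2 [_ J2]; split; first by rewrite (F2.1 32 isT).
  move=> i j iln jn; apply: J2 => //.
  by apply: (@leq_trans (i.+1 * n)); [rewrite mulSn; lia|rewrite leq_mul2r iln orbT].
by rewrite /=; lia.
Qed.

(** * From a maximum matching to the size of a maximum independent set *)

Lemma count_card (a : nat -> bool) : count a (iota 0 n) = #|[set i : 'I_n | a i]|.
Proof.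
rewrite -sum1_count -/(index_iota 0 n) -{1}[n]subn0 -/(index_iota 0 n) big_mkord -sum1_card.
by apply: eq_bigl => i; rewrite inE.
Qed.

Definition independent (sd : nat -> nat) (I : {set 'I_n}) : Prop :=
  (forall x : 'I_n, x \in I -> sd x != 0) /\ {in I &, forall x y : 'I_n, ~~ conflict sd x y}.

Definition is_alpha (sd : nat -> nat) (k : nat) : Prop :=
  (forall I, independent sd I -> #|I| <= k) /\ exists I, independent sd I /\ #|I| = k.

Definition uncovered (sd p : nat -> nat) i :=
  (sd i == 2) || (sd i == 1) && ~~ (0 < p i <= n).

Lemma near_sym i j : near i j = near j i.
Proof. by rewrite /near sqdC addrC. Qed.

Lemma conflict_sym sd i j : conflict sd i j = conflict sd j i.
Proof. by rewrite /conflict addnC near_sym. Qed.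

Lemma conflict_bipartite sd : (forall i, sd i <= 2) ->
  is_bipartite (fun i j : 'I_n => conflict sd i j).
Proof.
move=> sd2; split; first by move=> i j; apply: conflict_sym.
exists [set i : 'I_n | sd i == 1] => x y /andP[+ _]; rewrite !inE.
by move: (sd x) (sd y) (sd2 x) (sd2 y) => [|[|[|]]] // [|[|[|]]].
Qed.

Lemma alpha_of_matching (sd p : nat -> nat) (M : {set {set 'I_n}}) : (forall i, sd i <= 2) ->
  is_maximum_matching (fun i j : 'I_n => conflict sd i j) M ->
  (forall i j : 'I_n, (p i == j.+1) = ([set i; j] \in M)) ->
  is_alpha sd (count (uncovered sd p) (iota 0 n)).
Proof.
move=> sd2 maxM Hp.
set e := (fun i j : 'I_n => conflict sd i j) in maxM *.
pose V1 := [set i : 'I_n | sd i == 1]; pose V2 := [set i : 'I_n | sd i == 2].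
have V12 : [disjoint V1 & V2].
  by rewrite disjoint_subset; apply/subsetP => i; rewrite !inE => /eqP->.
have e_sym : symmetric e by move=> i j; apply: conflict_sym.
have e_side x y : e x y -> (x \in V1) && (y \in V2) || (x \in V2) && (y \in V1).
  rewrite /e /conflict !inE => /andP[+ _].
  by move: (sd x) (sd y) (sd2 x) (sd2 y) => [|[|[|]]] // [|[|[|]]].
have cov (i : 'I_n) : covered M i = (0 < p i <= n).
  apply/existsP/idP => [[j]|/andP[p0 pn]].
    by rewrite -Hp => /eqP->; rewrite /= ltn_ord.
  have pn' : (p i).-1 < n by lia.
  by exists (Ordinal pn'); rewrite -Hp /= prednK.
have -> : count (uncovered sd p) (iota 0 n) = #|V2| + #|exposed V1 M|.
  rewrite count_card -cardsUI.
  have -> : V2 :&: exposed V1 M = set0.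
    apply/setP => i; rewrite !inE; apply/negP => /andP[/eqP->]; by [].
  rewrite cards0 addn0; congr #|pred_of_set _|; apply/setP => i.
  by rewrite !inE /uncovered cov.
have indE I : independent sd I <-> I \subset V1 :|: V2 /\ {in I &, forall x y, ~~ e x y}.
  split=> [[H1 H2]|[H1 H2]]; split=> //.
    apply/subsetP => x /H1; rewrite !inE.
    by move: (sd x) (sd2 x) => [|[|[|]]].
  move=> x /(subsetP H1); rewrite !inE => /orP[]/eqP-> //.
have up I : independent sd I -> #|I| <= #|V2| + #|exposed V1 M|.
  by move=> /indE[H1 H2]; apply: (independent_card_le V12 e_sym e_side maxM.1).
split=> //.
have [I [H1 H2 H3]] := independent_card_max V12 e_sym e_side maxM.
have indI : independent sd I by apply/indE.
by exists I; split=> //; apply/eqP; rewrite eqn_leq H3 up.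
Qed.

Lemma hw_count sd p s : ints s 0 0 = n -> (forall i, i < n -> ints s 15 i = sd i) ->
  (forall i, i < n -> ints s 34 i = p i) ->
  halts_within Count s (n * 60 + 20) (fun s' => ints s' 17 0 = count (uncovered sd p) (iota 0 n)).
Proof.
move=> E0 Hs Hp.
apply: (@hw_seq _ _ _ _ 3 (n * 60 + 17)); last by lia.
apply: hw_ev => // F1.
apply: (@hw_for _ _ _ _ (fun k s => ints s 17 0 = count (uncovered sd p) (iota 0 k)) n 48) => //.
- by move=> s' [FI _]; rewrite /= (FI 0 isT) /= /update /= E0.
- move=> k s2 kn F2 Ek I2; apply: hw_ev => // _ _.
  have T2 : beval s2 UncoveredTest = uncovered sd p k.
    rewrite /UncoveredTest beval_or beval_eqI beval_and beval_eqI beval_not beval_and !beval_leI.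
    rewrite /= Ek (F2.1 15 isT) (F2.1 34 isT) (F2.1 0 isT).
    rewrite /= /update /= Hs // Hp // E0 //.
  rewrite [ev _ _](_ : _ = if uncovered sd p k then State (update (ints s2) 17 0 (ints s2 17 0 + 1)) (reals s2) else s2).
    have -> : count (uncovered sd p) (iota 0 k.+1) = ints s2 17 0 + uncovered sd p k.
      by rewrite -addn1 iotaD count_cat add0n /= addn0 -I2.
    by case: uncovered; rewrite /= /update /= ?addn0.
  by rewrite -T2.
by rewrite /=; lia.
Qed.

Variables (matching : com) (f : nat -> nat).
Hypothesis Hmatching : computes_bipartite_matching R matching f.

(** The specification of the matching program allows arbitrary initial contents elsewhere, so it can
    be called again on memory left dirty by earlier calls. *)
Lemma hw_matching s (e : rel 'I_n) : is_bipartite e -> ints s 32 0 = n ->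
  (forall i j : 'I_n, ints s 33 (i * n + j) = e i j) ->
  halts_within (shift matching) s (f n) (fun s' => exists M, is_maximum_matching e M /\
     forall i j : 'I_n, (ints s' 34 i == j.+1) = ([set i; j] \in M)).
Proof.
move=> be E0 E1.
have [t [s' [Ex tT [M [maxM HM]]]]] := Hmatching be (s := view s) (conj E0 E1).
have [S' ES Es'] := exec_shift Ex erefl.
by exists t, S'; split=> //; exists M; split=> //; move: HM; rewrite Es'.
Qed.

Lemma hw_evalg d (al : nat -> bool) s : genv d s ->
  (forall i, i < n -> (ints s 16 i == 0) = al i) ->
  halts_within (EvalG matching) s (f n + n * n * 1100)
    (fun s' => is_alpha (sideb d al) (ints s' 17 0)).
Proof.
move=> Gs Ha.
have sd2 i : sideb d al i <= 2 by rewrite /sideb; do 2 case: ifP => //.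
apply: (@hw_seq _ _ _ _ (n * (n * 340 + 340) + 40) (f n + n * (n * 140 + 100) + 60)); last by nia.
apply: hw_weak (hw_sides Gs Ha) _ _ => // s1 F1 S1 _.
have G1 : genv d s1 by apply: genv_frame Gs F1 isT _.
apply: (@hw_seq _ _ _ _ (n * (n * 140 + 40) + 40) (f n + n * 60 + 20)); last by nia.
apply: hw_weak (hw_build G1 S1) _ _ => // s2 F2 [E32 E33] _.
have G2 : genv d s2 by apply: genv_frame G1 F2 isT _.
have S2 i : i < n -> ints s2 15 i = sideb d al i by rewrite (F2.1 15 isT); apply: S1.
apply: (@hw_seq _ _ _ _ (f n) (n * 60 + 20)); last by lia.
have be := conflict_bipartite sd2.
apply: hw_weak (hw_matching be E32 _) _ _ => //; first by move=> i j; apply: E33.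
move=> s3 F3 [M [maxM HM]] _.
have E0 : ints s3 0 0 = n by rewrite (F3.1 0 (nowI_shift _ _)) //; case: G2 => [[]].
have S3 i : i < n -> ints s3 15 i = sideb d al i by rewrite (F3.1 15 (nowI_shift _ _)) //; apply: S2.
apply: hw_weak (hw_count E0 S3 (p := ints s3 34) _) _ _ => // s4 _ ->.
exact: (alpha_of_matching sd2 maxM HM).
Qed.

End Guess.
Global Opaque EvalG.

(** * The clique program *)

(* Array 18 holds the size of the best clique found, array 19 its guess. *)
Definition Prepare : com :=
  Seq (SetI 11 (K 0) (IAdd (V 6) (V 6)))
  (Seq (SetI 18 (K 0) (K 0)) (For 3 (V 0) (SetI 16 (V 3) (K 0)))).

Definition Improve : com :=
  Ite (BNot (BLeI (V 17) (V 18)))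
    (Seq (SetI 18 (K 0) (V 17)) (For 3 (V 11) (SetI 19 (V 3) (IGet 8 (V 3))))) Skip.

Definition Enumerate (matching : com) : com :=
  Odo 8 11 0 9 10 (Seq (EvalG matching) Improve).

Definition Shrink (matching : com) : com :=
  For 20 (V 0) (Seq (SetI 16 (V 20) (K 1)) (Seq (EvalG matching)
    (Ite (BNot (BLeI (V 18) (V 17))) (SetI 16 (V 20) (K 0)) Skip))).

Definition Output : com := For 3 (V 0) (SetI 1 (V 3) (ISub (K 1) (IGet 16 (V 3)))).

Definition Main (matching : com) : com :=
  Seq Virtual (Seq Search (Seq (Copy4 21 14) (Seq EvalN (Seq Prepare
  (Seq (Enumerate matching) (Seq (For 3 (V 11) (SetI 8 (V 3) (IGet 19 (V 3))))
  (Seq (Shrink matching) Output))))))).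

Lemma nowI_enumerate a matching : a < 32 ->
  a \notin [:: 3; 4; 5; 15; 17; 8; 9; 10; 18; 19] -> nowI a (Enumerate matching).
Proof.
move=> a32; rewrite !inE !negb_or /= => /and5P[N3 N4 N5 N15 /and5P[N17 -> -> -> /andP[-> ->]]].
by rewrite N3 nowI_evalg // !inE !negb_or N3 N4 N5 N15.
Qed.

Lemma nowI_shrink a matching : a < 32 ->
  a \notin [:: 3; 4; 5; 15; 17; 16; 20] -> nowI a (Shrink matching).
Proof.
move=> a32; rewrite !inE !negb_or /= => /and5P[N3 N4 N5 N15 /and3P[N17 -> ->]].
by rewrite nowI_evalg // !inE !negb_or N3 N4 N5 N15.
Qed.

Arguments Enumerate : simpl never.
Arguments Shrink : simpl never.

Section Main.
Variables (R : realType) (n : nat) (P : nat -> nat -> R) (rad : nat -> R).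
Implicit Types (s : state R) (d c cl : nat -> nat).
Hypothesis n0 : 0 < n.

Local Notation nearb := (near P rad).

Definition near_clique (S : {set 'I_n}) := {in S &, forall x y : 'I_n, nearb x y}.

(** * Correctness of guesses, apart from the program *)

Section Pure.
Variables (c cl : nat -> nat) (m : nat).
Hypothesis cl_same : forall i j, i < n -> j < n -> (cl i == cl j) = same P rad c i j.
Hypothesis cl_lt : forall i, i < n -> cl i < m.

Local Notation side := (sideb n P rad c cl m).

(** Balls on opposite sides are near because they do not conflict. On the same side
    [guess_same_side] applies with the squared sum of the two radii as [D], since guessed balls have
    the radius of their class. *)
Lemma independent_near d al (I : {set 'I_n}) : valid P c ->
  (forall j, j < m + m -> d j < n) -> independent P rad (side d al) I -> near_clique I.
Proof.
move=> Hc Hd [I1 I2] x y xI yI.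
have ok (z : 'I_n) : z \in I -> okb n P rad c cl m d z.
  by move=> /I1; rewrite /sideb; case: okb; rewrite ?andbT ?andbF.
have sE (z : 'I_n) : z \in I -> side d al z = if upb P c cl m d z then 1 else 2.
  by move=> /I1; rewrite /sideb; case: ifP.
have := I2 x y xI yI; rewrite /conflict !sE //.
have [xok yok] := (ok x xI, ok y yI).
case/and4P: (xok) => vx x1 x2 /allP xn; case/and4P: (yok) => vy y1 y2 /allP yn.
have Ld (z : 'I_n) : d (cl z) < n.
  by apply: Hd; apply: leq_trans (cl_lt (ltn_ord z)) (leq_addr _ _).
have Rd (z : 'I_n) : d (m + cl z) < n.
  by apply: Hd; rewrite ltn_add2l cl_lt.
have sm (z : 'I_n) : validb cl m d z -> same P rad c (d (cl z)) z /\ same P rad c (d (m + cl z)) z.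
  by rewrite /validb !cl_same // => /andP[].
have [/andP[/eqP a1 /eqP a2] /andP[/eqP a3 /eqP a4]] := sm x vx.
have [/andP[/eqP b1 /eqP b2] /andP[/eqP b3 /eqP b4]] := sm y vy.
have H1 : nearb x (d (cl y)) && nearb x (d (m + cl y)).
  by have := xn y; rewrite mem_iota /= add0n ltn_ord vy; apply.
have H2 : nearb y (d (cl x)) && nearb y (d (m + cl x)).
  by have := yn x; rewrite mem_iota /= add0n ltn_ord vx; apply.
move: H1 H2; rewrite /near a2 a4 b2 b4 => /andP[e1 e2] /andP[e3 e4].
rewrite [(rad y + rad x)%R]addrC in e3 e4.
case: (upb P c cl m d x =P upb P c cl m d y) => [E _|]; last first.
  by case: (upb P c cl m d x) (upb P c cl m d y) => [] [] //= _; rewrite negbK.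
exact: (guess_same_side Hc a1 a3 x1 x2 b1 b3 y1 y2 e1 e2 e3 e4 E).
Qed.

Lemma exists_guess (S : {set 'I_n}) : near_clique S -> S != set0 ->
  exists2 t, t < n ^ (m + m) & independent P rad (side (dig n t) xpredT) S.
Proof.
move=> HS /set0Pn[k0 k0S].
(* A class without members in [S] gets the arbitrary member [k0] of [S]. Thus every guessed ball
   lies in [S] and is near all of [S]. *)
have pick_ext (h : nat -> R) j : exists v : 'I_n, v \in S /\
   forall x : 'I_n, x \in S -> cl x = j -> cl v = j /\ (h v <= h x)%R.
  case: (pickP [pred x : 'I_n | (x \in S) && (cl x == j)]) => [x0 Hx0|Hno].
    case: (arg_minP (fun x : 'I_n => h x) Hx0) => v /andP[vS /eqP vj] Hv.
    by exists v; split=> // x xS xj; split=> //; apply: Hv; rewrite /= xS xj eqxx.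
  by exists k0; split=> // x xS xj; have := Hno x; rewrite /= xS xj eqxx.
have [gl Hgl] := choice (pick_ext (hX P c)).
have [gr Hgr] := choice (pick_ext (fun x => - hX P c x)%R).
(* The first [m] digits are left ends and the next [m] right ends; the latter minimise the negated
   coordinate. *)
pose g j : nat := if j < m then gl j else gr (j - m).
have [|t tb Ht] := @dig_surj n (m + m) g n0; first by move=> j _; rewrite /g; case: ifP.
exists t => //.
have EL (x : nat) : x < n -> dig n t (cl x) = gl (cl x).
  move=> xn; have H := cl_lt xn; rewrite Ht; first by rewrite /g H.
  exact: leq_trans H (leq_addr _ _).
have ER (x : nat) : x < n -> dig n t (m + cl x) = gr (cl x).
  move=> xn; have H := cl_lt xn; rewrite Ht ?ltn_add2l // /g.
  by rewrite ltnNge leq_addr /= addnC addnK.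
have okS (x : 'I_n) : x \in S -> okb n P rad c cl m (dig n t) x.
  move=> xS; rewrite /okb /validb EL // ER //.
  have [lS Hl] := Hgl (cl x); have [rS Hr] := Hgr (cl x).
  have [E1 ->] := Hl x xS erefl; have [E2] := Hr x xS erefl.
  rewrite lerN2 => ->; rewrite E1 E2 !eqxx /=.
  apply/allP => y; rewrite mem_iota add0n => /= yn; apply/implyP => _.
  rewrite EL // ER //; have [lS' _] := Hgl (cl y); have [rS' _] := Hgr (cl y).
  by rewrite !HS.
split=> [x xS|x y xS yS]; first by rewrite /sideb okS //; case: ifP.
by rewrite /conflict HS // andbF.
Qed.

(** The side of a remaining ball depends on the guess only, not on which other balls are deleted. *)
Lemma side_sub d (A B : nat -> bool) (I : {set 'I_n}) : (forall x : 'I_n, x \in I -> A x -> B x) ->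
  independent P rad (side d A) I -> independent P rad (side d B) I.
Proof.
move=> AB [I1 I2].
have E (x : 'I_n) : x \in I -> side d B x = side d A x.
  move=> xI; have := I1 x xI; rewrite /sideb; case Ax: (A x) => //= _.
  by rewrite (AB x xI Ax).
split=> [x xI|x y xI yI]; first by rewrite E // I1.
by have := I2 x y xI yI; rewrite /conflict !E.
Qed.

End Pure.

(** * Running the program *)

Section Run.
Variables (c cl : nat -> nat) (m : nat).
Hypothesis cl_same : forall i j, i < n -> j < n -> (cl i == cl j) = same P rad c i j.
Hypothesis cl_lt : forall i, i < n -> cl i < m.
Hypothesis m_le : m <= n.
Variables (matching : com) (f : nat -> nat).
Hypothesis Hmatching : computes_bipartite_matching R matching f.

Local Notation side := (sideb n P rad c cl m).
Local Notation alpha := (is_alpha n P rad).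

Lemma m_gt0 : 0 < m.
Proof. exact: leq_trans (cl_lt n0). Qed.

Definition pgenv s : Prop :=
  [/\ env n P rad s, forall i, i < n -> reals s 9 i = hX P c i /\ reals s 10 i = hY P c i,
      ints s 6 0 = m /\ ints s 11 0 = m + m & forall i, i < n -> ints s 7 i = cl i].

Lemma pgenv_frame C s s' : pgenv s -> frame C s s' -> all (fun a => nowI a C) [:: 0; 6; 7; 11] ->
  (forall a, a < 11 -> nowR a C) -> pgenv s'.
Proof.
move=> [G1 G2 [G3 G3'] G4] [FI FR] NI NR.
have HI a : a \in [:: 0; 6; 7; 11] -> ints s' a = ints s a by move=> Ha; apply/FI/(allP NI).
have HR a : a < 11 -> reals s' a = reals s a by move=> Ha; apply/FR/NR.
split; rewrite ?HI ?HR //.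
by apply: env_eq G1 _ _; [apply: HI|move=> l l4; apply: HR; apply: ltn_trans l4 _].
Qed.

Lemma genv_of s d : pgenv s -> (forall j, j < m + m -> ints s 8 j = d j /\ d j < n) ->
  genv n P rad c cl m d s.
Proof. by move=> [G1 G2 [G3 _] G4] Hd; split. Qed.

Lemma hw_enumerate s : pgenv s -> ints s 18 0 = 0 -> (forall i, i < n -> ints s 16 i = 0) ->
  halts_within (Enumerate matching) s
   (n ^ (m + m) * (f n + n * n * 1300) + n * 40 + 20)
   (fun s' => (forall t (I : {set 'I_n}), t < n ^ (m + m) ->
        independent P rad (side (dig n t) xpredT) I -> #|I| <= ints s' 18 0) /\
      (ints s' 18 0 = 0 \/ exists d, (forall j, j < m + m -> ints s' 19 j = d j /\ d j < n) /\
          alpha (side d xpredT) (ints s' 18 0))).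
Proof.
move=> Gs B0 D0.
have mm0 : 0 < m + m by rewrite addn_gt0 m_gt0.
have [[E0 _ _] _ [E6 E11] _] := Gs.
apply: (@hw_odo _ _ _ _ _ _ (m + m) n _ (fun t s =>
   (forall t' (I : {set 'I_n}), t' < t -> independent P rad (side (dig n t') xpredT) I -> #|I| <= ints s 18 0) /\
   (ints s 18 0 = 0 \/ exists d, (forall j, j < m + m -> ints s 19 j = d j /\ d j < n) /\
          alpha (side d xpredT) (ints s 18 0))) (f n + n * n * 1100 + n * 50 + 40)) => //.
- by rewrite /= !nowI_evalg.
- move=> t s1 s2 [I1 I2] Hi _; rewrite (Hi 18) // (Hi 19) //.
- by split=> //; left.
- move=> t s1 tb F1 Hd [I1 I2].
  have G1 : pgenv s1.
    apply: (pgenv_frame Gs F1); first by rewrite /all !nowI_enumerate.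
    by move=> a a11; rewrite /= nowR_evalg //; apply: ltn_trans a11 _.
  have D1 i : i < n -> (ints s1 16 i == 0) = xpredT i by move=> ni; rewrite (F1.1 16 (nowI_enumerate _ _ _)) // D0.
  have Hd' j : j < m + m -> ints s1 8 j = dig n t j /\ dig n t j < n.
    by move=> jm; rewrite Hd // dig_lt.
  apply: (@hw_seq _ _ _ _ (f n + n * n * 1100) (n * 50 + 40)); last by lia.
  apply: hw_weak (hw_evalg n0 cl_lt Hmatching (genv_of G1 Hd') D1) _ _ => // s2 F2 A2 _.
  have G2 : pgenv s2.
    apply: (pgenv_frame G1 F2); first by rewrite /= !nowI_evalg.
    by move=> a a11; rewrite nowR_evalg //; apply: ltn_trans a11 _.
  have E18 : ints s2 18 = ints s1 18 by rewrite (F2.1 18) // nowI_evalg.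
  have E19 : ints s2 19 = ints s1 19 by rewrite (F2.1 19) // nowI_evalg.
  have Hd2 j : j < m + m -> ints s2 8 j = dig n t j by move=> jm; rewrite (F2.1 8) ?Hd // nowI_evalg.
  have [_ _ [_ E112] _] := G2.
  apply: (@hw_ite _ _ _ _ _ (n * 50 + 30)); last by rewrite /=; lia.
    rewrite /= -ltnNge E18 => lt.
    apply: (@hw_seq _ _ _ _ 5 (n * 50 + 25)); last by lia.
    apply: hw_ev => // F3; set s3 := ev _ s2 in F3 *.
    have E3 : ints s3 18 0 = ints s2 17 0 by [].
    have E113 : ints s3 11 0 = m + m by [].
    have Hd3 j : j < m + m -> ints s3 8 j = dig n t j by apply: Hd2.
    clearbody s3.
    apply: (@hw_for _ _ _ _ (fun k s => forall j, j < k -> ints s 19 j = dig n t j) (m + m) 8) => //.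
    + by move=> s' [FI _]; rewrite /= (FI 11 isT).
    + move=> k s4 km F4 Ek I4; apply: hw_ev => // _ _ j; rewrite /= /update /= Ek.
      move=> /ltn_S_inv[->|jk]; first by rewrite eqxx (F4.1 8 isT) Hd3.
      by rewrite (ltn_eqF jk) I4.
    + move=> s4 F4 I4 _; rewrite (F4.1 18 isT) E3; split.
        move=> t' I /ltn_S_inv[->|tt']; first exact: A2.1.
        by move=> HI; apply: leq_trans (I1 t' I tt' HI) (ltnW lt).
      by right; exists (dig n t); split=> // j jm; rewrite I4 // dig_lt.
    by rewrite /=; lia.
  rewrite /= negbK E18 => le.
  apply: hw_ev => //; first by rewrite /=; lia.
  move=> _ /=; rewrite E18 E19; split=> //.
  move=> t' I /ltn_S_inv[->|tt']; last exact: I1.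
  by move=> /A2.1 H; apply: leq_trans H le.
(* There are at most [n] classes, so saving the guess and turning the odometer cost only [O(n)] per
   guess. *)
have H1 : n ^ (m + m) * (f n + n * n * 1100 + n * 50 + 40 + (m + m) * 40 + 30) <=
   n ^ (m + m) * (f n + n * n * 1300) by rewrite leq_mul2l; apply/orP; right; nia.
by lia.
Qed.

(** The invariant keeps the optimum [k0] among the remaining balls [A], and every examined ball
    still in [A] belongs to all independent sets of size [k0]. At the end such a set must be all of
    [A]. *)
Lemma hw_shrink d k0 s : pgenv s -> (forall j, j < m + m -> ints s 8 j = d j /\ d j < n) ->
  (forall i, i < n -> ints s 16 i = 0) -> ints s 18 0 = k0 -> alpha (side d xpredT) k0 ->
  halts_within (Shrink matching) s (n * (f n + n * n * 1100 + 70) + 20)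
    (fun s' => exists I : {set 'I_n}, [/\ independent P rad (side d xpredT) I, #|I| = k0 &
        forall i : 'I_n, (ints s' 16 i == 0) = (i \in I)]).
Proof.
move=> Gs Hd D0 B0 A0.
have [[E0 _ _] _ [E6 E11] _] := Gs.
apply: (@hw_for _ _ _ _ (fun k s => exists A : nat -> bool,
   [/\ forall i, i < n -> (ints s 16 i == 0) = A i, forall i, k <= i < n -> A i, alpha (side d A) k0 &
     forall y : 'I_n, y < k -> A y -> forall I, independent P rad (side d A) I -> y \notin I -> #|I| < k0])
   n (f n + n * n * 1100 + 40)) => //.
- by rewrite /= nowI_evalg.
- by move=> s' [FI _]; rewrite /= (FI 0 (nowI_shrink _ _ _)).
- by exists xpredT; split=> // i ni; rewrite /= update_neq // D0.
- move=> k s1 kn F1 Ek [A [I1 I2 I3 I4]].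
  have G1 : pgenv s1.
    apply: (pgenv_frame Gs F1); first by rewrite /all !nowI_shrink.
    by move=> a a11; rewrite /= nowR_evalg //; apply: ltn_trans a11 _.
  have Hd1 j : j < m + m -> ints s1 8 j = d j /\ d j < n.
    by rewrite (F1.1 8 (nowI_shrink _ _ _)) //; apply: Hd.
  have B1 : ints s1 18 0 = k0 by rewrite (F1.1 18 (nowI_shrink _ _ _)).
  apply: (@hw_seq _ _ _ _ 4 (f n + n * n * 1100 + 30)); last by lia.
  apply: hw_ev => // F2; set s2 := ev _ s1 in F2 *.
  have G2 : pgenv s2 by apply: (pgenv_frame G1 F2).
  have Hd2 : forall j, j < m + m -> ints s2 8 j = d j /\ d j < n by exact: Hd1.
  have B2 : ints s2 18 0 = k0 by exact: B1.
  have k2 : ints s2 20 0 = k by exact: Ek.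
  pose A1 i := A i && (i != k).
  have D2 i : i < n -> (ints s2 16 i == 0) = A1 i.
    by move=> ni; rewrite /s2 /A1 /= /update /= Ek; case: (i == k); [rewrite andbF|rewrite andbT I1].
  have D2' i : i != k -> ints s2 16 i = ints s1 16 i.
    by move=> ni; rewrite /s2 /= /update /= Ek (negbTE ni).
  clearbody s2.
  apply: (@hw_seq _ _ _ _ (f n + n * n * 1100) 20); last by lia.
  apply: hw_weak (hw_evalg n0 cl_lt Hmatching (genv_of G2 Hd2) D2) _ _ => // s3 F3 A3 _.
  have E18 : ints s3 18 0 = k0 by rewrite (F3.1 18) // nowI_evalg.
  have E20 : ints s3 20 0 = k by rewrite (F3.1 20) // nowI_evalg.
  have E16 : ints s3 16 = ints s2 16 by rewrite (F3.1 16) // nowI_evalg.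
  have toA (I : {set 'I_n}) : independent P rad (side d A1) I -> independent P rad (side d A) I.
    by apply: side_sub => x _ /andP[].
  apply: hw_ev => // _ _.
  rewrite [ev _ _](_ : _ = if ints s3 17 0 < k0 then State (update (ints s3) 16 k 0) (reals s3) else s3); last first.
    by rewrite /= E18 E20 -ltnNge.
  case: ltnP => lt.
    exists A; split=> //.
    + move=> i ni; rewrite /= /update /=; have [->|ik] := eqVneq i k.
        by rewrite I2 // leqnn kn.
      by rewrite E16 D2' // I1.
    + by move=> i /andP[ki ni]; apply: I2; rewrite ni ltnW.
    + move=> y /ltn_S_inv[yk|yk] Ay I HI yI; last exact: (I4 y).
      apply: leq_ltn_trans lt; apply: A3.1.
      apply: side_sub HI => x xI Ax; rewrite /A1 Ax /=.
      by apply: contra yI => /eqP xk; rewrite (_ : y = x) //; apply: val_inj; rewrite /= xk.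
  (* Deleting a ball cannot raise the optimum, so if it did not drop it is unchanged and ball [k]
     stays deleted. *)
  have Ek0 : ints s3 17 0 = k0.
    apply/eqP; rewrite eqn_leq lt andbT; have [I [HI <-]] := A3.2.
    by apply: I3.1; apply: toA.
  exists A1; split.
  + by move=> i ni; rewrite /= /update /= E16 D2.
  + by move=> i /andP[ki ni]; rewrite /A1 I2 ?ni ?(ltnW ki) //= neq_ltn ki orbT.
  + by rewrite -Ek0.
  + move=> y /ltn_S_inv[yk|yk] Ay I HI yI; first by move: Ay; rewrite /A1 yk eqxx andbF.
    by apply: (I4 y yk _ I _ yI); [case/andP: Ay|apply: toA].
- move=> s1 F1 [A [I1 I2 I3 I4]].
  have [I [HI cI]] := I3.2.
  exists I; split=> //; first by apply: side_sub HI.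
  move=> i; rewrite I1 //; apply/idP/idP => [Ai|iI].
    apply: contraT => iNI; have := I4 i (ltn_ord i) Ai I HI iNI.
    by rewrite cI ltnn.
  by have := HI.1 i iI; rewrite /sideb; case: (A i).
by rewrite /=; lia.
Qed.

End Run.

Lemma near_refl i : nearb i i.
Proof.
by rewrite /near (_ : sqd _ _ = 0%R) ?sqr_ge0 // /sqd /dotv /subv; ring.
Qed.

Variables (matching : com) (f : nat -> nat).
Hypothesis Hmatching : computes_bipartite_matching R matching f.

Lemma hw_main M s : virtual_points P n -> ints s 0 0 = n ->
  (forall l, l < 3 -> forall x, x < n -> reals s l x = P l x) ->
  (forall x, x < n -> reals s 3 x = rad x) ->
  (exists c, [/\ forall j, j < 4 -> c j < n + 3, valid P c, ncl P n rad c <= M &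
     M <= 1 -> c 0 = 0 /\ c 2 = 0]) ->
  halts_within (Main matching) s
    (((n + 3) ^ 2 * (n * n * 650 + 80) + (if M <= 1 then 0 else (n + 3) ^ 4 * (n * n * 650 + 160))) +
     n ^ (M + M) * (f n + n * n * 1300) + n * (f n + n * n * 1100) + n * n * 500 + n * 300 + 600)
    (fun s' => exists S : {set 'I_n}, [/\ near_clique S,
       forall S' : {set 'I_n}, near_clique S' -> #|S'| <= #|S| &
       forall i : 'I_n, (ints s' 1 i != 0) = (i \in S)]).
Proof.
move=> HV E0 HP Hr [c0 [c01 c02 c03 c04]].
set T2 := (n + 3) ^ 2 * _; set T4 := if M <= 1 then _ else _.
set TE := n ^ (M + M) * _; set TS := n * (f n + _).
apply: (@hw_seq _ _ _ _ 100 (T2 + T4 + TE + TS + n * n * 500 + n * 300 + 500)); last by lia.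
apply: hw_weak (hw_virtual n0 HP E0 Hr HV) _ _ => // s1 _ G1 _.
apply: (@hw_seq _ _ _ _ (T2 + T4 + 250) (TE + TS + n * n * 500 + n * 300 + 250)); last by lia.
have Hsmall : M <= 1 -> exists c, [/\ forall j, j < 4 -> c j < n + 3, c 0 = 0 /\ c 2 = 0, valid P c & ncl P n rad c <= 1].
  by move=> M1; exists c0; split=> //; [exact: c04|exact: leq_trans c03 M1].
apply: hw_weak (hw_search n0 G1 Hsmall) _ _ => // s2 F2 [S2 B2] _.
have G2 := env_frame G1 F2 isT isT.
have M0 : 0 < M by apply: leq_trans c03; apply: ncl_gt0.
(* A record of at most 1 is fine because [M] is positive; with a larger record all candidates were
   tried, [c0] among them. *)
have best_le : ints s2 13 0 <= M.
  case: (leqP (ints s2 13 0) 1) => [H|H]; first exact: leq_trans H M0.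
  by apply: leq_trans c03; apply: B2 => //; right.
have [c [Hc Hv Em]] : exists c : nat -> nat,
    [/\ forall j, j < 4 -> ints s2 14 j = c j /\ c j < n + 3, valid P c &
        ints s2 13 0 = ncl P n rad c].
  case: S2 => // E13; have := B2 c0 c01 c02.
  have := ncl_leq_n P n rad c0; rewrite E13 => H1 H2.
  have : n < n by apply: leq_trans (H2 _) H1; right; rewrite ltnS.
  by rewrite ltnn.
rewrite Em in best_le.
apply: (@hw_seq _ _ _ _ 20 (TE + TS + n * n * 500 + n * 300 + 230)); last by lia.
apply: hw_ev => // F3; set s3 := ev _ s2 in F3 *.
have G3 := env_frame G2 F3 isT isT.
have Hc3 j : j < 4 -> ints s3 21 j = c j /\ c j < n + 3.
  by move=> j4; have := Hc j j4; case: j j4 => [|[|[|[|]]]].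
clearbody s3.
apply: (@hw_seq _ _ _ _ (n * n * 500) (TE + TS + n * 300 + 230)); last by lia.
apply: hw_weak (hw_evaln n0 G3 Hc3) _ _ => // s4 F4 [[H4 H4'] [C1 C2 C3]] _.
have G4 := env_frame G3 F4 isT isT.
set m := ncl P n rad c in C1 C3 best_le.
pose cl := ints s4 7.
have m_le : m <= n by apply: ncl_leq_n.
apply: (@hw_seq _ _ _ _ (n * 30 + 30) (TE + TS + n * 270 + 200)); last by lia.
apply: (@hw_seq _ _ _ _ 7 (n * 30 + 20)); last by lia.
apply: hw_ev => // F5; set s5 := ev _ s4 in F5 *.
have P5 : pgenv c cl m s5.
  split; first exact: (env_frame G4 F5).
  - by move=> i /H4'[].
  - by rewrite /s5 /= /update /= !C1.
  - by [].
clearbody s5.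
apply: (@hw_seq _ _ _ _ 3 (n * 30 + 17)); last by lia.
apply: hw_ev => // F6; set s6 := ev _ s5 in F6 *.
have P6 : pgenv c cl m s6 by apply: (pgenv_frame P5 F6).
have B6 : ints s6 18 0 = 0 by [].
clearbody s6.
apply: (@hw_for _ _ _ _ (fun k s => forall i, i < k -> ints s 16 i = 0) n 4) => //.
- by move=> s' [FI _]; rewrite /= (FI 0 isT); case: P6 => [[]].
- move=> k s' _ _ Ek I' ; apply: hw_ev => // _ _ i; rewrite /= /update /= Ek.
  by move=> /ltn_S_inv[->|ik]; rewrite ?eqxx // (ltn_eqF ik) I'.
- move=> s7 F7 D7 _.
  have P7 : pgenv c cl m s7 by apply: (pgenv_frame P6 F7).
  have B7 : ints s7 18 0 = 0 by rewrite (F7.1 18 isT).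
  clear s5 F5 P5 s6 F6 P6 B6 F7.
  have TEm : n ^ (m + m) * (f n + n * n * 1300) <= TE.
    by rewrite leq_mul2r; apply/orP; right; rewrite leq_pexp2l // leq_add.
  apply: (@hw_seq _ _ _ _ (TE + n * 40 + 20) (TS + n * 230 + 180)); last by lia.
  apply: hw_weak (hw_enumerate C3 m_le Hmatching P7 B7 D7) _ _; first by lia.
  move=> s8 F8 [M8 S8] _.
  have P8 : pgenv c cl m s8.
    apply: (pgenv_frame P7 F8); first by rewrite /all !nowI_enumerate.
    by move=> a a11; rewrite /= nowR_evalg //; apply: ltn_trans a11 _.
  have D8 i : i < n -> ints s8 16 i = 0 by rewrite (F8.1 16 (nowI_enumerate _ _ _)) //; apply: D7.
  have max8 (S : {set 'I_n}) : near_clique S -> #|S| <= ints s8 18 0.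
    move=> HS; have [->|SN] := eqVneq S set0; first by rewrite cards0.
    by have [t tb Ht] := exists_guess c C3 HS SN; apply: M8 tb Ht.
  (* A single ball is a clique, so the best size is positive and a guess has been recorded. *)
  have pos8 : 0 < ints s8 18 0.
    have : near_clique [set Ordinal n0] by move=> x y /set1P-> /set1P->; apply: near_refl.
    by move/max8; rewrite cards1.
  case: S8 => [Z|[d [Hd Ad]]]; first by rewrite Z in pos8.
  apply: (@hw_seq _ _ _ _ (n * 60 + 20) (TS + n * 170 + 160)); last by lia.
  apply: (@hw_for _ _ _ _ (fun k s => forall j, j < k -> ints s 8 j = d j) (m + m) 8) => //.
  + by move=> s' [FI _]; rewrite /= (FI 11 isT); case: P8 => _ _ [].
  + move=> k s' km F' Ek I'; apply: hw_ev => // _ _ j; rewrite /= /update /= Ek.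
    move=> /ltn_S_inv[->|jk]; last by rewrite (ltn_eqF jk) I'.
    by rewrite eqxx (F'.1 19 isT); have [] := Hd k km.
  + move=> s9 F9 I9 _.
    have P9 : pgenv c cl m s9 by apply: (pgenv_frame P8 F9).
    have Hd9 j : j < m + m -> ints s9 8 j = d j /\ d j < n.
      by move=> jm; rewrite I9 //; have [] := Hd j jm.
    have D9 i : i < n -> ints s9 16 i = 0 by rewrite (F9.1 16 isT); apply: D8.
    have B9 : ints s9 18 0 = ints s8 18 0 by rewrite (F9.1 18 isT).
    apply: (@hw_seq _ _ _ _ (TS + n * 70 + 20) (n * 100 + 140)); last by lia.
    apply: hw_weak (hw_shrink C3 m_le Hmatching P9 Hd9 D9 B9 Ad) _ _.
      by rewrite /TS mulnDr; lia.
    move=> s10 F10 [I [HI cI DI]] _.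
    have P10 : pgenv c cl m s10.
      apply: (pgenv_frame P9 F10); first by rewrite /all !nowI_shrink.
      by move=> a a11; rewrite /= nowR_evalg //; apply: ltn_trans a11 _.
    apply: (@hw_for _ _ _ _ (fun k s => forall i, i < k -> ints s 1 i = 1 - ints s10 16 i) n 8) => //.
    * by move=> s' [FI _]; rewrite /= (FI 0 isT); case: P10 => [[]].
    * move=> k s' km F' Ek I'; apply: hw_ev => // _ _ j; rewrite /= /update /= Ek.
      move=> /ltn_S_inv[->|jk]; last by rewrite (ltn_eqF jk) I'.
      by rewrite eqxx (F'.1 16 isT).
    * move=> s11 _ I11; exists I; split.
      - by apply: (independent_near C2 C3 Hv _ HI) => j jm; have [] := Hd j jm.
      - by move=> S' /max8; rewrite cI.
      - by move=> i; rewrite I11 // -DI; case: (ints s10 16 i) => [|[|]].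
    by rewrite /=; lia.
  by rewrite /=; lia.
by rewrite /=; lia.
Qed.

End Main.

(** * From balls to the program *)

(** From [n + 3 <= 4 * n], the cheap search costs [O(n ^ 4)], within [n ^ (M + M) * n ^ 2]. The full
    search costs [O(n ^ 6)], which fits only because it is charged for [M >= 2], where
    [n ^ 4 <= n ^ (M + M)]. *)
Lemma time_bound n M F : 0 < n -> 0 < M ->
  (n + 3) ^ 2 * (n * n * 650 + 80) + (if M <= 1 then 0 else (n + 3) ^ 4 * (n * n * 650 + 160)) +
     n ^ (M + M) * (F + n * n * 1300) + n * (F + n * n * 1100) + n * n * 500 + n * 300 + 600
  <= 500 * 500 * (n ^ (M + M) * (F + n * n)).
Proof.
move=> n0 M0; set E := n ^ (M + M); set X := n * n.
have X0 : 0 < X by rewrite muln_gt0 n0.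
have nX : n <= X by rewrite leq_pmull.
have XE : X <= E by rewrite /X /E mulnn leq_pexp2l //; lia.
have E0 : 0 < E by apply: leq_trans XE.
have b2 : (n + 3) ^ 2 <= 16 * X.
  by rewrite /X mulnn -[16]/(4 ^ 2) -expnMn leq_exp2r //; lia.
have b4 : 1 < M -> (n + 3) ^ 4 <= 256 * E.
  move=> M1; apply: (@leq_trans ((4 * n) ^ 4)); first by rewrite leq_exp2r //; lia.
  by rewrite expnMn; apply: leq_mul => //; rewrite leq_pexp2l //; lia.
have XX : X * X <= E * X by rewrite leq_mul2r XE orbT.
have t1 : (n + 3) ^ 2 * (X * 650 + 80) <= 120 * 100 * (E * X).
  apply: (@leq_trans (16 * X * (730 * X))); first by apply: leq_mul => //; lia.
  by rewrite mulnACA; apply: leq_mul; [lia|exact: XX].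
have t2 : (if M <= 1 then 0 else (n + 3) ^ 4 * (X * 650 + 160)) <= 500 * 420 * (E * X).
  case: (leqP M 1) => [_|M1]; first exact: leq0n.
  have b := b4 M1; apply: (@leq_trans (256 * E * (810 * X))).
    by apply: leq_mul => //; lia.
  by rewrite mulnACA; apply: leq_mul; [lia|exact: leqnn].
have t3 : n * (F + X * 1100) <= E * (F + X * 1100).
  by rewrite leq_mul2r (leq_trans nX XE) orbT.
have t4 : X <= E * X by rewrite leq_pmull.
move: t1 t2; set A := _ * (X * 650 + 80); set B := if _ then _ else _ => t1 t2.
have expand a : E * (F + X * a) = E * F + E * X * a by rewrite mulnDr mulnA.
rewrite expand in t3; rewrite expand (mulnDr E).
clearbody A B; clear b2 b4 expand.
move: (n * (F + _)) (E * F) (E * X) t1 t2 t3 t4 => Z1 Z2 Z3 t1 t2 t3 t4.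
by clearbody X; clear - t1 t2 t3 t4 X0 nX; lia.
Qed.

Section Balls.
Variables (R : realType) (n : nat) (center : 'I_n -> 'rV[R]_3) (radius : 'I_n -> R).
Hypothesis n0 : 0 < n.
Hypothesis radius_gt0 : forall i, (0 < radius i)%R.
Local Open Scope ring_scope.

Let i0 : 'I_n := Ordinal n0.

Definition points (l x : nat) : R :=
  if insub x is Some i then center i ord0 (inord l : 'I_3)
  else center i0 ord0 (inord l : 'I_3) + (l == x - n)%N%:R.

Definition radii (x : nat) : R := if insub x is Some i then radius i else 0.

Lemma points_ord l (i : 'I_n) : points l i = center i ord0 (inord l : 'I_3).
Proof. by rewrite /points valK. Qed.

Lemma radii_ord (i : 'I_n) : radii i = radius i.
Proof. by rewrite /radii valK. Qed.

Lemma points_virtual : virtual_points points n.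
Proof.
move=> l t l3 t3; rewrite -[0%N]/(val i0) points_ord /points insubN ?addKn //.
by rewrite -leqNgt leq_addr.
Qed.

Lemma sum3 (F : 'I_3 -> R) : \sum_(l < 3) F l = F (inord 0) + F (inord 1) + F (inord 2).
Proof.
rewrite !big_ord_recr big_ord0 /= add0r.
by congr (F _ + F _ + F _); apply: val_inj; rewrite /= inordK.
Qed.

(** The machine has no square roots; squaring is harmless since sums of radii are nonnegative. *)
Lemma ball_graph_near i j : ball_graph center radius i j = (i != j) && near points radii i j.
Proof.
rewrite /ball_graph /edist sum3 /near /sqd /dotv /subv /pt !points_ord !radii_ord; congr (_ && _).
have s0 : 0 <= radius i + radius j by rewrite addr_ge0 // ltW.
by rewrite -{1}[radius i + radius j]ger0_norm // -sqrtr_sqr ler_sqrt ?sqr_ge0 //.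
Qed.

Lemma near_cliqueE (S : {set 'I_n}) :
  near_clique points radii S <-> is_clique (ball_graph center radius) S.
Proof.
split=> H x y xS yS; first by move=> xy; rewrite ball_graph_near xy H.
have [->|xy] := eqVneq x y; first exact: near_refl.
by have := H x y xS yS xy; rewrite ball_graph_near => /andP[].
Qed.

(** With [r * k <= 1] there is a single plane, and any difference [b - a] is the difference of [b]
    and [a] taken from the first center, so [G] may be restricted to that base point. Otherwise
    every coplanar difference is allowed, and the subtracted one is zero. *)
Lemma planes_candidate r k : num_radii radius = k -> on_parallel_planes center r ->
  (0 < r * k)%N /\ exists c, [/\ forall j, (j < 4)%N -> (c j < n + 3)%N, valid points c,
    (ncl points n radii c <= r * k)%N & (r * k <= 1)%N -> c 0%N = 0%N /\ c 2%N = 0%N].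
Proof.
move=> Hk [u0 [h [u0N h_inj Hpl]]].
have [jj Hjj] := choice Hpl.
pose u (l : nat) := u0 ord0 (inord l : 'I_3).
have Upos : 0 < dotv u u.
  rewrite lt0r dotv_ge0 andbT; apply: contra u0N => /eqP/dotv_eq0[z0 z1 z2].
  apply/eqP/rowP => l; rewrite mxE -[l]inord_val.
  by case: (val l) (ltn_ord l) => [|[|[|]]].
pose pl (x : nat) : nat := if insub x is Some i then jj i else 0%N.
have plE (i : 'I_n) : pl i = jj i by rewrite /pl valK.
have plu x y : (x < n)%N -> (y < n)%N -> pl x = pl y -> dotv u (subv (pt points y) (pt points x)) = 0.
  move=> xn yn; rewrite -[x]/(val (Ordinal xn)) -[y]/(val (Ordinal yn)) !plE => /val_inj E.
  have H (i : 'I_n) : dotv u (pt points i) = h (jj i).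
    by rewrite -Hjj sum3 /dotv /pt !points_ord.
  have -> : dotv u (subv (pt points (Ordinal yn)) (pt points (Ordinal xn))) =
     dotv u (pt points (Ordinal yn)) - dotv u (pt points (Ordinal xn)) by rewrite /dotv /subv; ring.
  by rewrite !H E subrr.
pose rs := undup [seq radius i | i <- enum 'I_n].
have rk (x : nat) : (x < n)%N -> (index (radii x) rs < k)%N.
  move=> xn; rewrite -Hk /num_radii -/rs index_mem -[x]/(val (Ordinal xn)) radii_ord mem_undup.
  by apply: map_f; rewrite mem_enum.
have plr x : (x < n)%N -> (pl x < r)%N.
  by move=> xn; rewrite -[x]/(val (Ordinal xn)) plE ltn_ord.
have r0 : (0 < r)%N by apply: leq_ltn_trans (plr 0%N n0).
have k0 : (0 < k)%N by apply: leq_ltn_trans (rk 0%N n0).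
split; first by rewrite muln_gt0 r0.
pose D a b := [/\ (a < n)%N, (b < n)%N & pl a = pl b].
pose G p q := D p q /\ ((r * k <= 1)%N -> p = 0%N).
have [||c [c1 c2 c3 [c4 c5]]] := @exists_candidate R points n points_virtual n0 u G D Upos.
- by move=> p q [[pn qn E] _]; split=> //; apply: plu.
- move=> a b Dab; have [an bn Eab] := Dab.
  case: (leqP (r * k) 1) => [small|big].
    have r1 : (r <= 1)%N by apply: leq_trans small; rewrite leq_pmulr.
    have pl0 x : (x < n)%N -> pl x = 0%N by move=> /plr; lia.
    exists 0%N, b, 0%N, a; split.
    + by split=> //; split=> //; rewrite !pl0.
    + by split=> //; split=> //; rewrite !pl0.
    + by move=> l _; rewrite /subv; ring.
  have NG p q : D p q -> G p q by move=> Dpq; split=> //; rewrite leqNgt big.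
  exists a, b, a, a; split; [exact: NG|by apply: NG|].
  by move=> l _; rewrite /subv; ring.
exists c; split=> //; last first.
  by move=> small; split; [case: c4|case: c5] => // -[_ ->].
(* Encodes the pair of plane and radius as a number below [r * k]. *)
pose idx x := (pl x * k + index (radii x) rs)%N.
apply: (@ncl_le _ _ _ _ _ idx).
  move=> i ni; rewrite /idx; apply: (@leq_trans ((pl i).+1 * k)).
    by rewrite mulSn addnC ltn_add2r rk.
  by rewrite leq_mul2r plr ?orbT.
move=> i j ni nj E; rewrite /idx in E.
have Ep : pl i = pl j.
  by have := congr1 (fun z => (z %/ k)%N) E; rewrite !divnMDl // !divn_small ?rk // !addn0.
have Er : radii i = radii j.
  move: E; rewrite Ep => /addnI E.
  have mem x : (x < n)%N -> radii x \in rs by move=> xn; rewrite -index_mem (_ : size rs = k) ?rk.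
  by rewrite -[LHS](nth_index 0 (mem i ni)) E nth_index // mem.
by rewrite /same Er eqxx andbT /hN; apply/eqP/c3; split.
Qed.

End Balls.

Theorem theorem5p3 (R : realType) (matching : com) (f : nat -> nat)
    (Hmatching : computes_bipartite_matching R matching f) :
  exists (clique : com) (C : nat),
    forall (n k r : nat) (center : 'I_n -> 'rV[R]_3) (radius : 'I_n -> R),
      (0 < n)%N ->
      (forall i, (0 < radius i)%R) ->
      num_radii radius = k ->
      on_parallel_planes center r ->
      computes_maximum_clique_of_balls clique center radius
        (C * (n ^ (2 * r * k) * (f n + n ^ 2 * r)))%N.
Proof.
exists (Main matching), (500 * 500) => n k r center radius n0 radius_gt0 Hk Hr s [E0 Ec Er].
have [rk0 [c0 Hc0]] := planes_candidate n0 Hk Hr.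
pose P := points center n0; pose rad := radii radius.
have HP l : l < 3 -> forall x, x < n -> reals s l x = P l x.
  move=> l3 x xn; rewrite -[x]/(val (Ordinal xn)) /P points_ord.
  by have := Ec (Ordinal xn) (inord l); rewrite inordK.
have Hrad x : x < n -> reals s 3 x = rad x.
  by move=> xn; rewrite -[x]/(val (Ordinal xn)) /rad radii_ord Er.
have := hw_main n0 Hmatching (points_virtual center n0) E0 HP Hrad (ex_intro _ c0 Hc0).
move/hw_weak; apply.
  apply: leq_trans (time_bound _ n0 rk0) _.
  rewrite leq_mul2l; apply/orP; right.
  have -> : 2 * r * k = r * k + r * k by rewrite -mulnA mul2n addnn.
  (* The program achieves [n ^ 2] in place of [n ^ 2 * r], and [r] is positive. *)
  apply: leq_mul => //; rewrite leq_add2l mulnn leq_pmulr //.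
  by move: rk0; rewrite muln_gt0 => /andP[].
move=> s' _ [S [S1 S2 S3]]; exists S; split; last by [].
split; first by apply/(near_cliqueE center n0 radius_gt0).
by move=> S' /(near_cliqueE center n0 radius_gt0)/S2.
Qed.
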